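(* Assume $f\in\mathbb L^\infty(\mathbb S^1)$ and Assumption (A). Then for every $n$ and every $m\in\mathcal M_n$, \[ \mathbb E\|\tilde f_m-f\|_2^2\ \le\ C_1\|f_m-f\|_2^2+C_2\frac{D_m}{n}+C_3\frac1n, \] where $f_m$ is the $\mathbb L^2$-orthogonal projection of $f$ onto $S_m$, $C_1,C_2$ depend only on $\sigma_0$, and $C_3$ depends only on $\sigma_0$ and $\|f\|_\infty$. In particular, if in addition $f\in W(\beta,R)$ for some $\beta>0$, $R>0$, and $m=m_n$ is chosen so that $D_{m_n}$ is (up to the parity constraint that $D_m$ is odd) equal to $\lfloor n^{1/(2\beta+1)}\rfloor$, then $\mathbb E\|\tilde f_{m_n}-f\|_2^2=O\big(n^{-2\beta/(2\beta+1)}\big)$ as $n\to\infty$.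
   Context: Circle convention: $\mathbb S^1\cong[0,2\pi)$, anticlockwise orientation; for $x,y\in\mathbb S^1$, $[x,y]$ is the usual interval if $x\le y$ and $[x,2\pi)\cup[0,y]$ if $x>y$. Model: $X$ has density $f$ on $\mathbb S^1$; $(L,U)$ is a random pair in $(\mathbb S^1)^2$ independent of $X$ with $L\ne U$ a.s.; $(X_i,L_i,U_i)_{i\le n}$ i.i.d. copies; $\Delta_i=\mathbf 1\{X_i\in[L_i,U_i]\}$, $X_i'=X_i$ if $\Delta_i=1$ and $-\pi$ otherwise; observations $(X_i',L_i,U_i)_{i\le n}$. $\sigma(x)=\mathbb P(x\in[L,U])$. Assumption (A): there is $\sigma_0>0$ with $\sigma\ge\sigma_0$ on $\mathbb S^1$. Trigonometric basis $\varphi_0=1/\sqrt{2\pi}$, $\varphi_{2j-1}=\pi^{-1/2}\cos(j\cdot)$, $\varphi_{2j}=\pi^{-1/2}\sin(j\cdot)$; $\mathcal M_n=\{1,\dots,\lfloor n/2\rfloor-1\}$; for $m\in\mathcal M_n$, $\Lambda_m=\{0,\dots,2m\}$, $S_m=\mathrm{span}\{\varphi_\lambda:\lambda\in\Lambda_m\}$, $D_m=2m+1$. $\hat G_m$: $(\hat G_m)_{\lambda\lambda'}=\frac1n\sum_i\int_{[L_i,U_i]}\varphi_\lambda\varphi_{\lambda'}$; $\hat U_m=(\frac1n\sum_i\Delta_i\varphi_\lambda(X_i))_{\lambda\in\Lambda_m}$ ($\hat G_m$ is a.s. invertible). Estimator: $\mathring f_m=\sum_{\lambda\in\Lambda_m}\hat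 a_\lambda\varphi_\lambda$ with $(\hat a_\lambda)=\hat G_m^{-1}\hat U_m$ (the minimizer over $S_m$ of the contrast $\zeta(t)=\frac1n\sum_i(\int t^2\mathbf 1_{[L_i,U_i]}-2\Delta_i t(X_i'))$), and $\tilde f_m=\mathring f_m\,\mathbf 1\{\|\mathring f_m\|_2^2\le n^2\}$. Sobolev class: $\alpha_j=j^\beta$ ($j$ even), $\alpha_j=(j+1)^\beta$ ($j$ odd); $W(\beta,R)=\{g\in\mathbb L^2(\mathbb S^1):\sum_j\alpha_j^2\langle g,\varphi_j\rangle_2^2<R^2/\pi^{2\beta}\}$. *)

(* Defs.v *)
From HB Require Import structures.
From mathcomp Require Import all_boot all_order all_algebra.
From mathcomp Require Import all_classical all_reals all_analysis.
Set Implicit Arguments. Unset Strict Implicit. Unset Printing Implicit Defensive.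
Import Order.TTheory GRing.Theory Num.Theory.
Import numFieldNormedType.Exports.
Local Open Scope classical_set_scope.
Local Open Scope ring_scope.

Section Defs.
Variable R : realType.

Notation leb := (@lebesgue_measure R).

Definition circle : set R := `[0, 2 * pi[%classic.

(* membership of t in the circular interval [l, u] (anticlockwise) *)
Definition arc_mem (l u t : R) : bool :=
  (0 <= t < 2 * pi) &&
  (if l <= u then (l <= t <= u) else (l <= t) || (t <= u)).

Definition arcset (l u : R) : set R := [set t | arc_mem l u t].

Definition phi (j : nat) (t : R) : R :=
  if j == 0%N then 1 / Num.sqrt (2 * pi)
  else if odd j then cos ((j.+1./2)%:R * t) / Num.sqrt pi
  else sin ((j./2)%:R * t) / Num.sqrt pi.

Definition l2sq (g : R -> R) : \bar R :=
  (\int[leb]_(t in circle) ((g t) ^+ 2)%:E)%E.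

Definition inner (g h : R -> R) : R := \int[leb]_(t in circle) (g t * h t).

(* one (uncensored) draw: (X, (L, U)) *)
Notation Z := (R * (R * R))%type.

Definition obs (z : Z) : Z :=
  (if arc_mem z.2.1 z.2.2 z.1 then z.1 else - pi, z.2).

(* Delta computed from an observation (X', L, U); -pi is never in the circle *)
Definition Delta (o : Z) : bool := arc_mem o.2.1 o.2.2 o.1.

(* the models space S_m has dimension D_m = 2m+1; indices Lambda_m = 'I_(2m+1) *)
Definition Ghat (m : nat) (s : seq Z) : 'M[R]_(2 * m + 1) :=
  \matrix_(i, j) ((size s)%:R^-1 *
     \sum_(o <- s) \int[leb]_(t in arcset o.2.1 o.2.2) (phi i t * phi j t)).

Definition Uhat (m : nat) (s : seq Z) : 'cV[R]_(2 * m + 1) :=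
  \col_i ((size s)%:R^-1 *
     \sum_(o <- s) (if Delta o then phi i o.1 else 0)).

Definition fring (m : nat) (s : seq Z) (t : R) : R :=
  let a := invmx (Ghat m s) *m Uhat m s in
  \sum_(i < 2 * m + 1) a i 0 * phi i t.

Definition ftilde (m : nat) (s : seq Z) (t : R) : R :=
  if (l2sq (fring m s) <= ((size s ^ 2)%N%:R)%:E)%E then fring m s t else 0.

Definition fproj (f : R -> R) (m : nat) (t : R) : R :=
  \sum_(i < 2 * m + 1) inner f (phi i) * phi i t.

(* Expectation of a nonnegative functional g of an i.i.d. n-sample
   (X_i, (L_i, U_i)) where X has density f on the circle and (L, U) has law
   mu, independent of X: iterated integral against the product law. *)
Fixpoint iexp (f : R -> R) (mu : {measure set (R * R)%type -> \bar R})
    (n : nat) (g : seq Z -> \bar R) : \bar R :=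
  match n with
  | 0%N => g [::]
  | k.+1 => (\int[leb]_(x in circle)
              ((f x)%:E * \int[mu]_p iexp f mu k (fun s => g ((x, p) :: s))))%E
  end.

Definition risk (f : R -> R) (mu : {measure set (R * R)%type -> \bar R})
    (n m : nat) : \bar R :=
  iexp f mu n (fun s => l2sq (fun t => ftilde m (map obs s) t - f t)).

Definition is_density (f : R -> R) : Prop :=
  measurable_fun circle f /\ (forall x, circle x -> 0 <= f x) /\
  (\int[leb]_(x in circle) (f x)%:E = 1)%E.

Definition LU_law (mu : {measure set (R * R)%type -> \bar R}) : Prop :=
  mu setT = 1%E /\ mu (circle `*` circle) = 1%E /\
  mu [set p | p.1 = p.2] = 0%E.

Definition sigma (mu : {measure set (R * R)%type -> \bar R}) (x : R) : \bar R :=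
  mu [set p | arc_mem p.1 p.2 x].

Definition Linf_bound (f : R -> R) (M : R) : Prop :=
  {ae leb, forall x, circle x -> `|f x| <= M}.

Definition Mset (n m : nat) : bool := (1 <= m)%N && (m <= n./2 - 1)%N.

Definition alpha (beta : R) (j : nat) : R :=
  if odd j then (j.+1)%:R `^ beta else j%:R `^ beta.

Definition sobolev (beta Rad : R) (g : R -> R) : Prop :=
  (\sum_(0 <= j <oo) ((alpha beta j) ^+ 2 * (inner g (phi j)) ^+ 2)%:E
     < (Rad ^+ 2 / pi `^ (2 * beta))%:E)%E.

End Defs.

(* Main.v *)
Require Import Defs.
From HB Require Import structures.
From mathcomp Require Import all_boot all_order all_algebra.
From mathcomp Require Import all_classical all_reals all_analysis.
From mathcomp Require Import measurable_realfun ring lra zify.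
Import Order.TTheory GRing.Theory Num.Theory.
Import numFieldNormedType.Exports.
Local Open Scope classical_set_scope.
Local Open Scope ring_scope.
Set Implicit Arguments. Unset Strict Implicit. Unset Printing Implicit Defensive.

(** The matrix [Ghat] is the compression to the trigonometric polynomials of
    the multiplication by the empirical coverage function [meanarc].  Cut the
    circle into a number of cells proportional to [n].  A circular interval
    whose upper end avoids a cell and which contains the left end of that cell
    contains the whole cell; all but a bounded number of cells have this
    property with probability at least [sigma0 / 2], and the exceptional cells
    are too short to carry half of the squared norm of a trigonometric
    polynomial of dimension at most [n].  Hence, by a Chernoff bound and a union
    bound over cells, [Ghat >= sigma0 / 16] outside an event of exponentially
    small probability, where the truncation at [n ^ 2] controls the loss.

    On the good event the error of the coefficients is controlled by
    [Uhat - Ghat a], where [a] are the Fourier coefficients of [f].  It splits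
    into a noise term, which is centered given [(L, U)] and has second moment of
    order [D_m / n], and a term bounded by the bias through Bessel's inequality.

    The rate follows from Parseval's identity, which comes from Fejer means of
    continuous approximations of [f]. *)

(** The law of [(L, U)] is arbitrary: [sigma] may jump and the upper end may have atoms, so refining
    the grid need not remove the exceptional cells. It only shrinks them, while their number stays
    at most [2 / sigma0]; this is why a number of cells proportional to [n] suffices. The
    expectation is an iterated integral of a loss whose measurability in the sample is not
    established. The loss is therefore majorized, sample by sample, by an explicit function: a
    constant, plus squares of sums of [noise], plus weighted products over the draws, one for each
    cell. This shape is stable under integrating out one draw, so a single induction yields the
    variance bound and the Chernoff bound together. The chain of constants is: hit probability
    [sigma0 / 2], mean weight [1 - sigma0 / 4], at least [sigma0 / 8 * n] hits, coercivity
    [sigma0 / 16]. In the oracle inequality the sup norm of [f] serves only to bound its squared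
    norm, on the bad event or when the truncation is active, hence it enters only [C3]. *)

(** * Square-integrable functions on the circle and their inner product *)

Section SquareIntegrable.
Context {R : realType}.
Implicit Types (g h : R -> R) (c : R).

Notation leb := (@lebesgue_measure R).
Notation circle := (@circle R).

Lemma circleE (t : R) : circle t <-> 0 <= t < 2 * pi.
Proof. by rewrite /Defs.circle /= in_itv. Qed.

Lemma measurable_circle : @measurable _ (measurableTypeR R) circle.
Proof. exact: measurable_itv. Qed.

Lemma lebesgue_circle : leb circle = (2 * pi)%:E.
Proof.
rewrite /Defs.circle lebesgue_measure_itv /= lte_fin mulr_gt0 ?pi_gt0//.
by rewrite -EFinB subr0.
Qed.

Lemma lebesgue_circle_lty : (leb circle < +oo)%E.
Proof. by rewrite lebesgue_circle ltry. Qed.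

(** [inner] is a real-valued integral, without meaning when the integral diverges. On this class
    products are integrable, so [inner] is bilinear there and [l2sq] is its diagonal. *)
Definition sqint h : Prop :=
  measurable_fun circle h /\
  leb.-integrable circle (EFin \o (fun t => h t ^+ 2)).

Lemma integrable_sqintM g h : sqint g -> sqint h ->
  leb.-integrable circle (EFin \o (fun t => g t * h t)).
Proof.
move=> [mg ig] [mh ih].
have := integrableD measurable_circle ig ih.
apply: le_integrable => //; first exact: measurable_circle.
  by apply/measurable_EFinP; exact: measurable_funM.
move=> t _ /=; rewrite lee_fin normrM [leRHS]ger0_norm ?addr_ge0 ?sqr_ge0//.
rewrite -(real_normK (num_real (g t))) -(real_normK (num_real (h t))).
have := sqr_ge0 (`|g t| - `|h t|); have := normr_ge0 (g t).
have := normr_ge0 (h t); nra.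
Qed.

Lemma sqint_bounded h c : measurable_fun circle h ->
  (forall t, circle t -> `|h t| <= c) -> sqint h.
Proof.
move=> mh hc; split=> //.
apply: measurable_bounded_integrable; first exact: measurable_circle.
- exact: lebesgue_circle_lty.
- exact: measurable_funX.
- exists (c ^+ 2); split; first exact: num_real.
  move=> x cx t ct /=; apply: (le_trans _ (ltW cx)).
  by rewrite normrX lerXn2r ?nnegrE ?hc// (le_trans _ (hc t ct)).
Qed.

Lemma sqint_cst c : sqint (fun=> c).
Proof. by apply: (@sqint_bounded _ `|c|) => //; exact: measurable_cst. Qed.

Lemma sqintD g h : sqint g -> sqint h -> sqint (fun t => g t + h t).
Proof.
move=> sg sh; have [mg ig] := sg; have [mh ih] := sh.
split; first exact: measurable_funD.
have igh := integrable_sqintM sg sh.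
have := integrableD measurable_circle (integrableD measurable_circle ig ih)
  (integrableZl measurable_circle 2 igh).
apply: eq_integrable; first exact: measurable_circle.
by move=> t _ /=; rewrite -!EFinM -!EFinD; congr EFin; ring.
Qed.

Lemma sqint_mulb g h c : measurable_fun circle g ->
  (forall t, circle t -> `|g t| <= c) -> sqint h -> sqint (fun t => g t * h t).
Proof.
move=> mg gc [mh ih]; split; first exact: measurable_funM.
have := integrableZl measurable_circle (c ^+ 2) ih.
apply: le_integrable; first exact: measurable_circle.
  by apply/measurable_EFinP/measurable_funX/measurable_funM.
move=> t ct /=; rewrite lee_fin exprMn.
have sq_ge0 (a b : R) : 0 <= a ^+ 2 * b ^+ 2 by rewrite mulr_ge0// sqr_ge0.
rewrite !ger0_norm// (ler_wpM2r (sqr_ge0 _))//.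
rewrite -(real_normK (num_real (g t))) lerXn2r ?nnegrE ?gc//.
exact: le_trans (gc _ ct).
Qed.

Lemma sqintZ c h : sqint h -> sqint (fun t => c * h t).
Proof. by apply: (@sqint_mulb _ _ `|c|) => //; exact: measurable_cst. Qed.

Lemma sqintB g h : sqint g -> sqint h -> sqint (fun t => g t - h t).
Proof.
move=> sg sh; have := sqintD sg (sqintZ (-1) sh).
by under [X in _ -> sqint X]eq_fun do rewrite -mulN1r.
Qed.

Lemma sqint_sum (I : Type) (r : seq I) (F : I -> R -> R) :
  (forall i, sqint (F i)) -> sqint (fun t => \sum_(i <- r) F i t).
Proof.
move=> sF; elim: r => [|i r IH].
  by under [X in sqint X]eq_fun do rewrite big_nil; exact: sqint_cst.
by under [X in sqint X]eq_fun do rewrite big_cons; exact: sqintD.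
Qed.

Lemma eq_inner g g' h h' : (forall t, circle t -> g t * h t = g' t * h' t) ->
  inner g h = inner g' h'.
Proof. by move=> gh; apply: eq_Rintegral => t /[!inE]; exact: gh. Qed.

Lemma innerC g h : inner g h = inner h g.
Proof. by apply: eq_inner => t _; rewrite mulrC. Qed.

Lemma innerDl g1 g2 h : sqint g1 -> sqint g2 -> sqint h ->
  inner (fun t => g1 t + g2 t) h = inner g1 h + inner g2 h.
Proof.
move=> s1 s2 sh; rewrite /inner -RintegralD; last 3 first.
- exact: measurable_circle.
- exact: integrable_sqintM.
- exact: integrable_sqintM.
by apply: eq_Rintegral => t _; rewrite mulrDl.
Qed.

Lemma innerZl c g h : sqint g -> sqint h ->
  inner (fun t => c * g t) h = c * inner g h.
Proof.
move=> sg sh; rewrite /inner -RintegralZl; last 2 first.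
- exact: measurable_circle.
- exact: integrable_sqintM.
by apply: eq_Rintegral => t _; rewrite mulrA.
Qed.

Lemma innerBl g1 g2 h : sqint g1 -> sqint g2 -> sqint h ->
  inner (fun t => g1 t - g2 t) h = inner g1 h - inner g2 h.
Proof.
move=> s1 s2 sh; rewrite /inner -RintegralB; last 3 first.
- exact: measurable_circle.
- exact: integrable_sqintM.
- exact: integrable_sqintM.
by apply: eq_Rintegral => t _; rewrite mulrBl.
Qed.

Lemma innerBr g h1 h2 : sqint g -> sqint h1 -> sqint h2 ->
  inner g (fun t => h1 t - h2 t) = inner g h1 - inner g h2.
Proof. by move=> *; rewrite !(innerC g); exact: innerBl. Qed.

Lemma inner_suml (I : Type) (r : seq I) (F : I -> R -> R) h :
  (forall i, sqint (F i)) -> sqint h ->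
  inner (fun t => \sum_(i <- r) F i t) h = \sum_(i <- r) inner (F i) h.
Proof.
move=> sF sh; elim: r => [|i r IH].
  transitivity (inner (fun t => 0 * h t) h).
    by apply: eq_inner => t _; rewrite big_nil !mul0r.
  by rewrite innerZl// mul0r big_nil.
rewrite big_cons -IH -innerDl //; last exact: sqint_sum.
by apply: eq_inner => t _; rewrite big_cons.
Qed.

Lemma inner_sumr (I : Type) (r : seq I) (F : I -> R -> R) h :
  (forall i, sqint (F i)) -> sqint h ->
  inner h (fun t => \sum_(i <- r) F i t) = \sum_(i <- r) inner h (F i).
Proof.
move=> sF sh; rewrite innerC inner_suml//.
by apply: eq_bigr => i _; rewrite innerC.
Qed.

Lemma le_inner g g' h h' : sqint g -> sqint g' -> sqint h -> sqint h' ->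
  (forall t, circle t -> g t * h t <= g' t * h' t) -> inner g h <= inner g' h'.
Proof.
move=> sg sg' sh sh' gh; apply: le_Rintegral => //.
- exact: measurable_circle.
- exact: integrable_sqintM.
- exact: integrable_sqintM.
Qed.

Lemma inner_ge0 g : 0 <= inner g g.
Proof. by apply: Rintegral_ge0 => t _; rewrite -expr2 sqr_ge0. Qed.

Lemma l2sqE g : sqint g -> l2sq g = (inner g g)%:E.
Proof.
move=> sg; rewrite /inner /Rintegral fineK.
  by apply: eq_integral => t _; rewrite expr2.
by apply: integrable_fin_num; [exact: measurable_circle|exact: integrable_sqintM].
Qed.

Lemma inner_sqB g h : sqint g -> sqint h ->
  inner (fun t => g t - h t) (fun t => g t - h t)
    = inner g g - 2 * inner g h + inner h h.
Proof.
move=> sg sh; rewrite innerBl ?innerBr//; last exact: sqintB.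
by rewrite (innerC h g); ring.
Qed.

Lemma inner_sqB_le g h : sqint g -> sqint h ->
  inner (fun t => g t - h t) (fun t => g t - h t)
    <= 2 * inner g g + 2 * inner h h.
Proof.
move=> sg sh; rewrite inner_sqB//; have := inner_ge0 (fun t => g t + h t).
rewrite innerDl ?(innerC _ (fun t => g t + h t)) ?innerDl//; last exact: sqintD.
rewrite (innerC h g); lra.
Qed.

End SquareIntegrable.

(** * Orthonormality and bounds of the trigonometric basis *)

Section TrigonometricBasis.
Context {R : realType}.
Implicit Types (w t : R) (j k : nat).

Notation leb := (@lebesgue_measure R).
Notation circle := (@circle R).

Lemma twopi_gt0 : 0 < 2 * pi :> R.
Proof. by rewrite mulr_gt0 ?pi_gt0. Qed.

Lemma Rintegral_circle_FTC (F f : R -> R) : continuous f ->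
  (forall x : R, is_derive x (1 : R) F (f x)) ->
  \int[leb]_(t in circle) f t = F (2 * pi) - F 0.
Proof.
move=> cf dF.
have cF x : {for x, continuous F}.
  by apply: differentiable_continuous; apply/derivable1_diffP; have := dF x.
rewrite /Rintegral /Defs.circle integral_itv_bndo_bndc; last first.
  apply/measurable_EFinP; apply: measurable_funTS; exact: continuous_measurable_fun.
rewrite (continuous_FTC2 twopi_gt0 (F := F))//.
- by apply: continuous_subspaceT.
- split.
  + by move=> x _; have := dF x; case.
  + by apply: cvg_at_right_filter; exact: cF.
  + by apply: cvg_at_left_filter; exact: cF.
- by move=> x _; rewrite derive1E; have := dF x; case.
Qed.

Lemma continuous_cosM w : continuous (fun t => cos (w * t)).
Proof.
move=> t; apply: (@continuous_comp _ _ _ (fun t => w * t) cos).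
  by apply: cvgMr; exact: cvg_id.
exact: continuous_cos.
Qed.

Lemma continuous_sinM w : continuous (fun t => sin (w * t)).
Proof.
move=> t; apply: (@continuous_comp _ _ _ (fun t => w * t) sin).
  by apply: cvgMr; exact: cvg_id.
exact: continuous_sin.
Qed.

Lemma is_derive_mulr w x : is_derive x (1 : R) (fun t => w * t) w.
Proof.
have -> : (fun t => w * t) = w \*: id by [].
by apply: is_derive_eq; rewrite /GRing.scale /= mulr1.
Qed.

Lemma Rintegral_cosM w : w != 0 -> sin (w * (2 * pi)) = 0 ->
  \int[leb]_(t in circle) cos (w * t) = 0.
Proof.
move=> w0 sw0.
have dF x : is_derive x (1 : R) (fun t => w^-1 * sin (w * t)) (cos (w * x)).
  have dw := is_derive_mulr w x.
  have := is_derive1_comp (is_derive_sin (w * x)) dw.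
  move=> /(is_deriveZ w^-1) => d; apply: (is_derive_eq (f := w^-1 \*: (sin \o  *%R w))).
  by rewrite /GRing.scale /=; field.
rewrite (Rintegral_circle_FTC _ dF); last exact: continuous_cosM.
by rewrite sw0 !mulr0 sin0 mulr0 subrr.
Qed.

Lemma Rintegral_sinM w : cos (w * (2 * pi)) = 1 ->
  \int[leb]_(t in circle) sin (w * t) = 0.
Proof.
move=> cw1; have [->|w0] := eqVneq w 0.
  rewrite /Rintegral integral0_eq// => t _; by rewrite mul0r sin0.
have dF x : is_derive x (1 : R) (fun t => (- w^-1) * cos (w * t)) (sin (w * x)).
  have dw := is_derive_mulr w x.
  have := is_derive1_comp (is_derive_cos (w * x)) dw.
  move=> /(is_deriveZ (- w^-1)) => d; apply: (is_derive_eq (f := - w^-1 \*: (cos \o  *%R w))).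
  by rewrite /GRing.scale /=; field.
rewrite (Rintegral_circle_FTC _ dF); last exact: continuous_sinM.
by rewrite cw1 mulr0 cos0 subrr.
Qed.

Lemma cos_nat_twopi k : cos (k%:R * (2 * pi)) = 1 :> R.
Proof.
have := periodicn (@cosD2pi R) k 0.
rewrite add0r cos0; suff -> : pi *+ 2 *+ k = k%:R * (2 * pi) :> R by [].
by rewrite !mulr_natl.
Qed.

Lemma sin_nat_twopi k : sin (k%:R * (2 * pi)) = 0 :> R.
Proof.
have := periodicn (@sinD2pi R) k 0.
rewrite add0r sin0; suff -> : pi *+ 2 *+ k = k%:R * (2 * pi) :> R by [].
by rewrite !mulr_natl.
Qed.

Lemma sqint_continuous_le (f : R -> R) (c : R) : continuous f ->
  (forall t, `|f t| <= c) -> sqint f.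
Proof.
move=> cf fc; apply: (@sqint_bounded _ _ c) => [|t _]; last exact: fc.
by apply: measurable_funTS; exact: continuous_measurable_fun.
Qed.

Lemma sqint_cosM w : sqint (fun t => cos (w * t)).
Proof.
apply: (@sqint_continuous_le _ 1); first exact: continuous_cosM.
by move=> t; exact: cos_max.
Qed.

Lemma sqint_sinM w : sqint (fun t => sin (w * t)).
Proof.
apply: (@sqint_continuous_le _ 1); first exact: continuous_sinM.
by move=> t; exact: sin_max.
Qed.

Lemma Rintegral_circle_cst (c : R) : \int[leb]_(t in circle) c = c * (2 * pi).
Proof.
rewrite Rintegral_cst; last exact: measurable_circle.
transitivity (c * fine ((2 * pi)%:E : \bar R)) => //; congr (_ * fine _).
exact: lebesgue_circle.
Qed.

(** Integrals of single functions are written as inner products with the constant 1, so that the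
    linearity lemmas of [inner] apply. Frequency 0 is kept, since product-to-sum formulas produce
    differences of equal frequencies. *)
Lemma inner1_cosM w : sin (w * (2 * pi)) = 0 ->
  inner (fun t => cos (w * t)) (fun=> 1) = (w == 0)%:R * (2 * pi).
Proof.
move=> sw; rewrite /inner; under eq_Rintegral do rewrite mulr1.
have [->|w0] := eqVneq w 0; last by rewrite Rintegral_cosM// mul0r.
under eq_Rintegral do rewrite mul0r cos0.
by rewrite Rintegral_circle_cst !mul1r.
Qed.

Lemma inner1_sinM w : cos (w * (2 * pi)) = 1 ->
  inner (fun t => sin (w * t)) (fun=> 1) = 0.
Proof.
by move=> cw; rewrite /inner; under eq_Rintegral do rewrite mulr1; exact: Rintegral_sinM.
Qed.

Lemma sin_natB_twopi j k : sin ((j%:R - k%:R) * (2 * pi)) = 0 :> R.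
Proof. by rewrite mulrBl sinB !sin_nat_twopi mul0r mulr0 subrr. Qed.

Lemma cos_natB_twopi j k : cos ((j%:R - k%:R) * (2 * pi)) = 1 :> R.
Proof. by rewrite mulrBl cosB !sin_nat_twopi !cos_nat_twopi mulr0 mulr1 addr0. Qed.

Lemma inner_cos_cos j k :
  inner (fun t => cos (j%:R * t)) (fun t => cos (k%:R * t)) =
  ((j == k)%:R + (j + k == 0)%N%:R) * pi.
Proof.
transitivity (inner (fun t => 2^-1 * (cos ((j%:R - k%:R) * t) + cos ((j + k)%:R * t)))
   (fun=> 1 : R)).
  by apply: eq_inner => t _; rewrite natrD mulrBl (mulrDl _ _ t) cosB cosD mulr1; field.
rewrite innerZl ?innerDl; try exact: sqint_cst; try exact: sqint_cosM; last first.
  by apply: sqintD; exact: sqint_cosM.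
rewrite !inner1_cosM ?sin_natB_twopi ?sin_nat_twopi//.
by rewrite subr_eq0 eqr_nat pnatr_eq0; field.
Qed.

Lemma inner_sin_sin j k :
  inner (fun t => sin (j%:R * t)) (fun t => sin (k%:R * t)) =
  ((j == k)%:R - (j + k == 0)%N%:R) * pi.
Proof.
transitivity (inner (fun t => 2^-1 * (cos ((j%:R - k%:R) * t) - cos ((j + k)%:R * t)))
   (fun=> 1 : R)).
  by apply: eq_inner => t _; rewrite natrD mulrBl (mulrDl _ _ t) cosB cosD mulr1; field.
rewrite innerZl ?innerBl; try exact: sqint_cst; try exact: sqint_cosM; last first.
  by apply: sqintB; exact: sqint_cosM.
rewrite !inner1_cosM ?sin_natB_twopi ?sin_nat_twopi//.
by rewrite subr_eq0 eqr_nat pnatr_eq0; field.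
Qed.

Lemma inner_sin_cos j k :
  inner (fun t => sin (j%:R * t)) (fun t => cos (k%:R * t)) = 0.
Proof.
transitivity (inner (fun t => 2^-1 * (sin ((j%:R - k%:R) * t) + sin ((j + k)%:R * t)))
   (fun=> 1 : R)).
  by apply: eq_inner => t _; rewrite natrD mulrBl (mulrDl _ _ t) sinB sinD mulr1; field.
rewrite innerZl ?innerDl; try exact: sqint_cst; try exact: sqint_sinM; last first.
  by apply: sqintD; exact: sqint_sinM.
by rewrite !inner1_sinM ?cos_natB_twopi ?cos_nat_twopi// addr0 mulr0.
Qed.

Lemma continuous_phi j : continuous (@phi R j).
Proof.
rewrite /phi; case: (j == 0%N); first exact: cst_continuous.
by case: (odd j) => t; apply: cvgMl;
  [exact: continuous_cosM|exact: continuous_sinM].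
Qed.

Lemma phi_sqr_le j t : (phi j t) ^+ 2 <= pi^-1.
Proof.
have pi0 := @pi_gt0 R.
have sq (x : R) : x ^+ 2 <= 1 -> (x / Num.sqrt pi) ^+ 2 <= pi^-1.
  move=> x1; rewrite exprMn exprVn sqr_sqrtr ?pi_ge0//.
  by rewrite ler_piMl// invr_ge0 pi_ge0.
rewrite /phi; case: (j == 0%N).
  rewrite div1r exprVn sqr_sqrtr ?(ltW twopi_gt0)// invfM ler_piMl ?invr_ge0 ?pi_ge0//.
  by rewrite invf_le1// ler1n.
by case: (odd j); apply: sq; [rewrite cos2sin2|rewrite sin2cos2]; rewrite gerBl sqr_ge0.
Qed.

Lemma phi_norm_le j t : `|phi j t| <= 1.
Proof.
rewrite -(@ler_pXn2r _ 2)// ?nnegrE// expr1n real_normK ?num_real//.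
apply: (le_trans (phi_sqr_le _ _)).
by rewrite invf_le1 ?pi_gt0// (le_trans _ (pi_ge2 _))// ler1n.
Qed.

Lemma measurable_phi j : measurable_fun setT (@phi R j).
Proof. by apply: continuous_measurable_fun; exact: continuous_phi. Qed.

Lemma sqint_phi j : sqint (@phi R j).
Proof.
by apply: (sqint_continuous_le (c := 1)); [exact: continuous_phi|exact: phi_norm_le].
Qed.

(** One shape for all indices: frequency [uphalf j], with index 0 seen as a cosine of frequency 0.
    Orthonormality then reduces to the three product integrals above. *)
Lemma phiE j : @phi R j = (fun t =>
  (if j == 0%N then (Num.sqrt (2 * pi))^-1 else (Num.sqrt pi)^-1) *
  (if odd j || (j == 0%N) then cos ((uphalf j)%:R * t) else sin ((uphalf j)%:R * t))).
Proof.
apply/funext => t; rewrite /phi; case: j => [|j] /=.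
  by rewrite mul0r cos0 mulr1 div1r.
rewrite orbF [RHS]mulrC; case: ifP => // /negbFE oj.
by congr (sin (_%:R * _) / _); rewrite uphalf_half oj.
Qed.

Lemma inner_phi i j : inner (@phi R i) (@phi R j) = (i == j)%:R.
Proof.
have pi0 := @pi_gt0 R; have tp0 := twopi_gt0.
have sp : Num.sqrt pi ^+ 2 = pi :> R by rewrite sqr_sqrtr ?pi_ge0.
have sp2 : Num.sqrt (2 * pi) ^+ 2 = 2 * pi :> R by rewrite sqr_sqrtr ?ltW.
have spn0 : Num.sqrt pi != 0 :> R by rewrite gt_eqF// sqrtr_gt0.
have sp2n0 : Num.sqrt (2 * pi) != 0 :> R by rewrite gt_eqF// sqrtr_gt0.
rewrite !phiE.
have sF b (k : nat) : sqint (fun t : R => if b then cos (k%:R * t) else sin (k%:R * t)).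
  by case: b; [exact: sqint_cosM|exact: sqint_sinM].
rewrite innerZl// ?(innerC _ (fun t => _ * (if odd j || _ then _ else _))); last exact: sqintZ.
rewrite innerZl// innerC.
set a := odd i || (i == 0%N); set b := odd j || (j == 0%N).
have -> : inner (fun t => if a then cos ((uphalf i)%:R * t) else sin ((uphalf i)%:R * t))
    (fun t => if b then cos ((uphalf j)%:R * t) else sin ((uphalf j)%:R * t)) =
    (a == b)%:R * ((uphalf i == uphalf j)%:R +
      (if a then 1 else -1) * (uphalf i + uphalf j == 0)%N%:R) * pi :> R.
  case: a; case: b; rewrite ?mul0r ?mul1r.
  - exact: inner_cos_cos.
  - by rewrite innerC inner_sin_cos.
  - exact: inner_sin_cos.
  - by rewrite mulN1r; exact: inner_sin_sin.
rewrite {}/a {}/b; case: i => [|i]; case: j => [|j] /=.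
- rewrite mulrA -invfM -expr2 sp2 !mul1r; clear -pi0.
  by move: pi pi0 => p p0; field; rewrite gt_eqF.
- by rewrite mulr0 addr0 mulr0 mul0r !mulr0.
- by rewrite mulr0 addr0 mulr0 mul0r !mulr0.
rewrite !orbF mulr0 addr0 mulrA -invfM -expr2 sp.
(* Parity and frequency together determine the index. *)
have -> : (i.+1 == j.+1) = (~~ odd i == ~~ odd j) && ((uphalf i.+1) == (uphalf j.+1)).
  by rewrite /= eqSS; move: (odd_double_half i) (odd_double_half j); lia.
rewrite -mulnb natrM; clear -pi0.
by move: pi pi0 => p p0; field; rewrite gt_eqF.
Qed.

End TrigonometricBasis.

(** * Trigonometric polynomials: Pythagoras, Bessel and a sup-norm bound *)

Section TrigonometricPolynomials.
Context {R : realType}.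
Implicit Types (h : R -> R).

Definition tpoly (d : nat) (a : 'I_d -> R) (t : R) : R := \sum_(i < d) a i * phi i t.

Lemma sqint_tpoly d (a : 'I_d -> R) : sqint (tpoly a).
Proof. by apply: sqint_sum => i; apply: sqintZ; exact: sqint_phi. Qed.

Lemma inner_tpolyr d (a : 'I_d -> R) h : sqint h ->
  inner h (tpoly a) = \sum_(i < d) a i * inner h (@phi R i).
Proof.
move=> sh; rewrite inner_sumr//; last first.
  by move=> i; apply: sqintZ; exact: sqint_phi.
apply: eq_bigr => i _; rewrite innerC innerZl// 1?innerC//; exact: sqint_phi.
Qed.

Lemma inner_tpoly_phi d (a : 'I_d -> R) (i : 'I_d) : inner (tpoly a) (@phi R i) = a i.
Proof.
rewrite innerC inner_tpolyr; last exact: sqint_phi.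
rewrite (bigD1 i)//= inner_phi eqxx mulr1 big1 ?addr0// => j ji.
by rewrite inner_phi (negbTE (_ : i != j :> nat)) ?mulr0// eq_sym.
Qed.

Lemma inner_tpoly d (a b : 'I_d -> R) :
  inner (tpoly a) (tpoly b) = \sum_(i < d) a i * b i.
Proof.
rewrite inner_tpolyr; last exact: sqint_tpoly.
by apply: eq_bigr => i _; rewrite inner_tpoly_phi mulrC.
Qed.

(** Pythagoras: distance to the projection plus distance between coefficients. Bessel's inequality,
    the optimality of [fproj] and the bias-variance split of the loss are all read off from it. *)
Lemma inner_sqB_tpoly d (a : 'I_d -> R) h : sqint h ->
  inner (fun t => tpoly a t - h t) (fun t => tpoly a t - h t) =
  inner h h - \sum_(i < d) inner h (@phi R i) ^+ 2
  + \sum_(i < d) (a i - inner h (@phi R i)) ^+ 2.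
Proof.
move=> sh; rewrite inner_sqB//; last exact: sqint_tpoly.
rewrite inner_tpolyr; last exact: sqint_tpoly.
rewrite (innerC (tpoly a) h) inner_tpolyr//.
have -> : \sum_(i < d) a i * inner (tpoly a) (@phi R i) = \sum_(i < d) a i ^+ 2.
  by apply: eq_bigr => i _; rewrite inner_tpoly_phi expr2.
under [X in _ = _ + X]eq_bigr do rewrite sqrrB.
rewrite big_split sumrB /= sumrMnl; ring.
Qed.

Lemma bessel d h : sqint h ->
  \sum_(i < d) inner h (@phi R i) ^+ 2 <= inner h h.
Proof.
move=> sh; have := inner_sqB_tpoly (fun i : 'I_d => inner h (@phi R i)) sh.
rewrite [X in _ + X]big1 ?addr0; last by move=> i _; rewrite subrr expr0n.
by move=> e; rewrite -subr_ge0 -e inner_ge0.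
Qed.

Lemma inner_sqB_fproj m h : sqint h ->
  inner (fun t => fproj h m t - h t) (fun t => fproj h m t - h t) =
  inner h h - \sum_(i < 2 * m + 1) inner h (@phi R i) ^+ 2.
Proof.
move=> sh; rewrite (inner_sqB_tpoly (fun i : 'I_(2 * m + 1) => inner h (@phi R i)))//.
by rewrite [X in _ + X]big1 ?addr0// => i _; rewrite subrr expr0n.
Qed.

(** The sum of the squares of [A * y i - B * x i] equals [A * (A * C - B ^+ 2)]; dividing by [A]
    requires the case [A = 0] to be treated apart. *)
Lemma sum_cauchy_schwarz (I : finType) (x y : I -> R) :
  (\sum_i x i * y i) ^+ 2 <= (\sum_i x i ^+ 2) * (\sum_i y i ^+ 2).
Proof.
set A := \sum_i x i ^+ 2; set B := \sum_i x i * y i; set C := \sum_i y i ^+ 2.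
have A0 : 0 <= A by apply: sumr_ge0 => i _; exact: sqr_ge0.
have : 0 <= \sum_i (A * y i - B * x i) ^+ 2 by apply: sumr_ge0 => i _; exact: sqr_ge0.
have -> : \sum_i (A * y i - B * x i) ^+ 2 = A ^+ 2 * C - 2 * A * B * B + B ^+ 2 * A.
  transitivity (\sum_i (A ^+ 2 * y i ^+ 2 - 2 * A * B * (x i * y i) + B ^+ 2 * x i ^+ 2)).
    by apply: eq_bigr => i _; ring.
  by rewrite big_split sumrB -!mulr_sumr.
move: A0; rewrite le_eqVlt => /predU1P[A0|A0 e].
  have x0 i : x i = 0.
    have : 0 <= A by rewrite -A0.
    move: A0 => /esym/eqP; rewrite /A psumr_eq0; last by move=> j _; exact: sqr_ge0.
    by move=> /allP/(_ i (mem_index_enum _)); rewrite /= sqrf_eq0 => /eqP.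
  by move=> _; rewrite -A0 mul0r /B big1 ?expr0n// => i _; rewrite x0 mul0r.
by rewrite -subr_ge0 -(pmulr_rge0 _ A0); move: e; congr (0 <= _); ring.
Qed.

(** The sup norm is compared with the squared norm at the price of the dimension; this keeps a short
    cell from carrying much of the norm of a polynomial. *)
Lemma tpoly_sqr_le d (a : 'I_d -> R) t :
  tpoly a t ^+ 2 <= (\sum_(i < d) a i ^+ 2) * (d%:R / pi).
Proof.
apply: (le_trans (sum_cauchy_schwarz _ _)).
apply: ler_wpM2l; first by apply: sumr_ge0 => i _; exact: sqr_ge0.
apply: (@le_trans _ _ (\sum_(i < d) pi^-1)).
  by apply: ler_sum => i _; exact: phi_sqr_le.
by rewrite sumr_const card_ord mulr_natl.
Qed.

End TrigonometricPolynomials.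

(** * Linear systems with a coercive matrix *)

Section CoerciveSystems.
Context {R : realType}.

(** Coercivity makes the squared norm of a kernel vector nonpositive. The transposes are there
    because [kermx] is the left kernel. *)
Lemma coercive_unitmx d (G : 'M[R]_d) (c : R) : 0 < c ->
  (forall v : 'cV[R]_d, c * \sum_i v i 0 ^+ 2 <= \sum_i v i 0 * (G *m v) i 0) ->
  G \in unitmx.
Proof.
move=> c0 Gc; rewrite -unitmx_tr -row_free_unit -kermx_eq0.
apply/eqP; apply/row_matrixP => k; rewrite row0; apply/eqP.
move: (row_sub k (kermx G^T)) => /sub_kermxP; set v := row k _ => vG.
have Gv : G *m v^T = 0 by rewrite -[G]trmxK -trmx_mul vG trmx0.
have := Gc v^T; rewrite Gv [leRHS]big1; last by move=> i _; rewrite [X in _ * X]mxE mulr0.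
rewrite pmulr_rle0// => v0.
apply/eqP/rowP => j; rewrite [RHS]mxE.
have := v0; rewrite le_eqVlt ltNge sumr_ge0 ?orbF; last by move=> i _; exact: sqr_ge0.
rewrite psumr_eq0; last by move=> i _; exact: sqr_ge0.
by move=> /allP/(_ j (mem_index_enum _)); rewrite /= sqrf_eq0 mxE => /eqP.
Qed.

(** With [w] the solution minus [a], [G *m w] is the residual, and coercivity at [w] bounds [w] by
    the residual. *)
Lemma coercive_solve_dist d (G : 'M[R]_d) (c : R) : 0 < c ->
  (forall v : 'cV[R]_d, c * \sum_i v i 0 ^+ 2 <= \sum_i v i 0 * (G *m v) i 0) ->
  forall u a : 'cV[R]_d,
  \sum_i ((invmx G *m u) i 0 - a i 0) ^+ 2
    <= c ^- 2 * \sum_i (u i 0 - (G *m a) i 0) ^+ 2.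
Proof.
move=> c0 Gc u a; have uG := coercive_unitmx c0 Gc.
pose w := invmx G *m u - a.
have Gw i : (G *m w) i 0 = u i 0 - (G *m a) i 0.
  by rewrite /w mulmxBr mulKVmx// !mxE.
have -> : \sum_i ((invmx G *m u) i 0 - a i 0) ^+ 2 = \sum_i w i 0 ^+ 2.
  by apply: eq_bigr => i _; rewrite /w !mxE.
under [X in _ <= _ * X]eq_bigr do rewrite -Gw.
have := Gc w; set A := \sum_i w i 0 ^+ 2; set B := \sum_i _ ^+ 2 => cA.
(* Young's inequality with weight [c]: the term in [A] is half of the left-hand side of [cA] and is
   absorbed there. *)
have : \sum_i w i 0 * (G *m w) i 0 <= c / 2 * A + (2 * c)^-1 * B.
  rewrite /A /B !mulr_sumr -big_split; apply: ler_sum => i _ /=.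
  move: (w i 0) ((G *m w) i 0) => x y.
  rewrite -subr_ge0.
  have -> : c / 2 * x ^+ 2 + (2 * c)^-1 * y ^+ 2 - x * y = (2 * c)^-1 * (c * x - y) ^+ 2.
    by field; rewrite gt_eqF.
  by rewrite mulr_ge0 ?sqr_ge0// invr_ge0 mulr_ge0// ltW.
move=> /(le_trans cA) cAB.
rewrite -(ler_pM2l (_ : 0 < c / 2)) ?divr_gt0//.
have -> : c / 2 * (c ^- 2 * B) = (2 * c)^-1 * B by field; rewrite gt_eqF.
lra.
Qed.

End CoerciveSystems.

(** * Deterministic error bounds for a fixed sample *)

Section ErrorDecomposition.
Context {R : realType}.
Notation Z := (R * (R * R))%type.
Notation leb := (@lebesgue_measure R).
Implicit Types (s : seq Z) (z : Z) (p : R * R) (f h : R -> R).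

Lemma measurable_arc_mem d (T : measurableType d) (l u t : T -> R) :
  measurable_fun setT l -> measurable_fun setT u -> measurable_fun setT t ->
  measurable_fun setT (fun x => arc_mem (l x) (u x) (t x)).
Proof.
move=> ml mu mt; rewrite /arc_mem.
have mc (c : R) : measurable_fun setT (fun _ : T => c) by exact: measurable_cst.
apply: measurable_and.
  by apply: measurable_and; [exact: measurable_fun_ler|exact: measurable_fun_ltr].
apply: measurable_fun_ifT; first exact: measurable_fun_ler.
  by apply: measurable_and; exact: measurable_fun_ler.
by apply: measurable_or; exact: measurable_fun_ler.
Qed.

Definition arcI p (t : R) : R := if arc_mem p.1 p.2 t then 1 else 0.

Lemma measurable_arcI d (T : measurableType d) (p : T -> R * R) (t : T -> R) :
  measurable_fun setT p -> measurable_fun setT t ->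
  measurable_fun setT (fun x => arcI (p x) (t x)).
Proof.
move=> mp mt; apply: measurable_fun_ifT; try exact: measurable_cst.
apply: measurable_arc_mem => //.
  by apply: measurableT_comp mp; exact: measurable_fst.
by apply: measurableT_comp mp; exact: measurable_snd.
Qed.

Lemma arcI_ge0 p t : 0 <= arcI p t.
Proof. by rewrite /arcI; case: ifP. Qed.

Lemma arcI_le1 p t : arcI p t <= 1.
Proof. by rewrite /arcI; case: ifP. Qed.

Lemma arcI_norm p t : `|arcI p t| <= 1.
Proof. by rewrite ger0_norm ?arcI_le1 ?arcI_ge0. Qed.

Lemma measurable_arcI_circle p : measurable_fun (@circle R) (arcI p).
Proof.
apply: measurable_funTS; apply: measurable_arcI; first exact: measurable_cst.
exact: measurable_id.
Qed.

Lemma sqint_arcI p h : sqint h -> sqint (fun t => arcI p t * h t).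
Proof.
apply: (@sqint_mulb _ _ _ 1) => [|t _]; first exact: measurable_arcI_circle.
exact: arcI_norm.
Qed.

(** [arc_mem] already requires [t] to lie on the circle, so integrating over the arc is integrating
    over the circle with weight [arcI]. *)
Lemma Rintegral_arcset p (g h : R -> R) :
  \int[leb]_(t in arcset p.1 p.2) (g t * h t) = inner (fun t => arcI p t * g t) h.
Proof.
have -> : arcset p.1 p.2 = @circle R `&` arcset p.1 p.2.
  apply/esym/setIidr => t; rewrite /arcset /= => /andP[t0 _].
  exact/circleE.
rewrite Rintegral_mkcondr /inner; apply: eq_Rintegral => t _.
rewrite patchE /arcI; case: ifPn => [|].
  by rewrite inE /arcset /= => ->; rewrite mul1r.
rewrite notin_setE /arcset /= => /negP/negbTE ->.
by rewrite !mul0r.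
Qed.

Definition meanarc s (t : R) : R := (size s)%:R^-1 * \sum_(z <- s) arcI z.2 t.

Lemma sum_arcI_bound s t : 0 <= \sum_(z <- s) arcI z.2 t <= (size s)%:R.
Proof.
apply/andP; split; first by apply: sumr_ge0 => z _; exact: arcI_ge0.
elim: s => [|z s IH]; first by rewrite big_nil.
by rewrite big_cons /= -natr1 addrC lerD// arcI_le1.
Qed.

Lemma meanarc_ge0 s t : 0 <= meanarc s t.
Proof. by rewrite mulr_ge0 ?invr_ge0//; have /andP[] := sum_arcI_bound s t. Qed.

Lemma meanarc_le1 s t : meanarc s t <= 1.
Proof.
rewrite /meanarc; case: s => [|z s]; first by rewrite big_nil mulr0.
by rewrite mulrC ler_pdivrMr ?ltr0n// mul1r; have /andP[] := sum_arcI_bound (z :: s) t.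
Qed.

Lemma measurable_meanarc s : measurable_fun (@circle R) (meanarc s).
Proof.
apply: measurable_funM; first exact: measurable_cst.
by apply: measurable_sum => z; exact: measurable_arcI_circle.
Qed.

Lemma sqint_meanarc s h : sqint h -> sqint (fun t => meanarc s t * h t).
Proof.
apply: (@sqint_mulb _ _ _ 1) => [|t _]; first exact: measurable_meanarc.
by rewrite ger0_norm ?meanarc_le1 ?meanarc_ge0.
Qed.

Lemma inner_meanarc s g h : sqint g -> sqint h ->
  inner (fun t => meanarc s t * g t) h =
  (size s)%:R^-1 * \sum_(z <- s) inner (fun t => arcI z.2 t * g t) h.
Proof.
move=> sg sh; rewrite -inner_suml => [|z|//]; last exact: sqint_arcI.
rewrite -innerZl//; last by apply: sqint_sum => z; exact: sqint_arcI.
by apply: eq_inner => t _; rewrite -mulr_suml /meanarc !mulrA.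
Qed.

Lemma Ghat_inner m s i j : Ghat m [seq obs z | z <- s] i j =
  inner (fun t => meanarc s t * phi i t) (@phi R j).
Proof.
rewrite inner_meanarc; try exact: sqint_phi.
rewrite mxE size_map big_map; congr (_ * _).
by apply: eq_bigr => z _; rewrite Rintegral_arcset.
Qed.

(** A censored draw is recorded with first coordinate [- pi], which is negative, so [Delta] is false
    on it; on the other draws [obs] changes nothing. *)
Lemma Uhat_sum m s i : Uhat m [seq obs z | z <- s] i 0 =
  (size s)%:R^-1 * \sum_(z <- s) arcI z.2 z.1 * phi i z.1.
Proof.
rewrite mxE size_map big_map; congr (_ * _).
apply: eq_bigr => z _; rewrite /Delta /obs /arcI /=.
case: (boolP (arc_mem z.2.1 z.2.2 z.1)) => [->|_]; first by rewrite mul1r.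
rewrite mul0r; suff -> : arc_mem z.2.1 z.2.2 (- pi) = false by [].
by rewrite /arc_mem oppr_ge0 leNgt pi_gt0.
Qed.

Lemma Ghat_mulmx m s (v : 'cV[R]_(2 * m + 1)) i :
  (Ghat m [seq obs z | z <- s] *m v) i 0 =
  inner (fun t => meanarc s t * tpoly (fun i => v i 0) t) (@phi R i).
Proof.
rewrite mxE; transitivity (inner (fun t => meanarc s t * phi i t) (tpoly (fun i => v i 0))).
  rewrite inner_tpolyr; last by apply: sqint_meanarc; exact: sqint_phi.
  by apply: eq_bigr => j _; rewrite Ghat_inner mulrC.
by rewrite innerC; apply: eq_inner => t _; rewrite mulrA (mulrC (tpoly _ t)).
Qed.

(** Centred at the conditional mean given [(L, U)], not at the global mean: the deviation of the
    empirical coverage from [sigma] then never appears, and the rest of the residual involves only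
    [meanarc] and the bias. *)
Definition noise f (i : nat) z : R :=
  arcI z.2 z.1 * phi i z.1 - inner (fun t => arcI z.2 t * f t) (@phi R i).

(** By orthonormality the sum of squares is the squared norm of [tpoly v], and the right-hand side
    is the quadratic form of [Ghat]. *)
Definition coercive m s (c : R) := forall v : 'I_(2 * m + 1) -> R,
  c * \sum_i v i ^+ 2 <= inner (fun t => meanarc s t * tpoly v t) (tpoly v).

Definition fring_coef m s : 'cV[R]_(2 * m + 1) :=
  invmx (Ghat m [seq obs z | z <- s]) *m Uhat m [seq obs z | z <- s].

Lemma fring_coef_dist m s f c : sqint f -> 0 < c -> coercive m s c ->
  \sum_i (fring_coef m s i 0 - inner f (@phi R i)) ^+ 2 <=
  c ^- 2 * (2 * inner (fun t => fproj f m t - f t) (fun t => fproj f m t - f t) +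
    2 * \sum_(i < 2 * m + 1) ((size s)%:R^-1 * \sum_(z <- s) noise f i z) ^+ 2).
Proof.
move=> sf c0 cG.
pose a : 'cV[R]_(2 * m + 1) := \col_i inner f (@phi R i).
have := @coercive_solve_dist _ _ (Ghat m [seq obs z | z <- s]) c c0 _
  (Uhat m [seq obs z | z <- s]) a.
under eq_bigr do rewrite [a _ _]mxE.
move=> H; apply: (le_trans (H _)) => {H}.
  move=> v; apply: (le_trans (cG _)).
  rewrite inner_tpolyr; last by apply: sqint_meanarc; exact: sqint_tpoly.
  by apply: ler_sum => i _; rewrite Ghat_mulmx.
apply: ler_wpM2l; first by rewrite invr_ge0 sqr_ge0.
have sP : sqint (fun t => fproj f m t - f t).
  by apply: sqintB => //; exact: sqint_tpoly.
pose b i := inner (fun t => meanarc s t * (fproj f m t - f t)) (@phi R i).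
(* Bessel is applied to the whole function [meanarc s] times the bias, so the squared bias is not
   multiplied by the dimension. *)
have bE : \sum_(i < 2 * m + 1) b i ^+ 2 <=
    inner (fun t => fproj f m t - f t) (fun t => fproj f m t - f t).
  apply: (le_trans (bessel _ (sqint_meanarc s sP))).
  apply: le_inner => //; try exact: sqint_meanarc.
  move=> t _; rewrite -!expr2 exprMn ler_piMl ?sqr_ge0//.
  by rewrite expr_le1 ?meanarc_le1 ?meanarc_ge0.
apply: (@le_trans _ _ (2 * \sum_(i < 2 * m + 1) b i ^+ 2 +
    2 * \sum_(i < 2 * m + 1) ((size s)%:R^-1 * \sum_(z <- s) noise f i z) ^+ 2)); last first.
  by rewrite lerD2r ler_pM2l.
rewrite !mulr_sumr -big_split /=; apply: ler_sum => i _.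
(* [Uhat] is the mean noise plus the coefficients of [meanarc s] times [f], while the product
   [Ghat a] consists of those of [meanarc s] times [fproj f m]. *)
have -> : Uhat m [seq obs z | z <- s] i 0 - (Ghat m [seq obs z | z <- s] *m a) i 0 =
    (size s)%:R^-1 * (\sum_(z <- s) noise f i z) - b i.
  rewrite /noise sumrB mulrBr -inner_meanarc//; last exact: sqint_phi.
  rewrite -Uhat_sum /b -addrA -opprD; congr (_ - _).
  rewrite Ghat_mulmx -innerDl; try exact: sqint_meanarc; last exact: sqint_phi.
  apply: eq_inner => t _; rewrite -mulrDr addrCA subrr addr0.
  by congr (_ * _ * _); apply: eq_bigr => j _; rewrite mxE.
move: (_ * \sum_(z <- s) _) (b i) => x y; have := sqr_ge0 (x + y); nra.
Qed.

Lemma fringE m s : fring m [seq obs z | z <- s] = tpoly (fun i => fring_coef m s i 0).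
Proof. by []. Qed.

Lemma sqint_fring m s : sqint (fring m [seq obs z | z <- s]).
Proof. by rewrite fringE; exact: sqint_tpoly. Qed.

Lemma ftildeE m s : ftilde m [seq obs z | z <- s] =
  if \sum_i fring_coef m s i 0 ^+ 2 <= (size s)%:R ^+ 2
  then fring m [seq obs z | z <- s] else (fun=> 0).
Proof.
apply/funext => t; rewrite /ftilde size_map natrX (l2sqE (sqint_fring _ _)) lee_fin.
rewrite {1}fringE inner_tpoly.
have -> : \sum_i fring_coef m s i 0 * fring_coef m s i 0 = \sum_i fring_coef m s i 0 ^+ 2.
  by apply: eq_bigr => i _; rewrite expr2.
by case: ifP.
Qed.

(** The crude bound for samples where [Ghat] may be badly conditioned: the truncation caps the
    squared norm of the estimator whatever the sample. *)
Lemma ftilde_l2sq_le m s f (M : R) : sqint f -> inner f f <= M ->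
  (l2sq (fun t => ftilde m [seq obs z | z <- s] t - f t)%R <=
     (2 * (size s)%:R ^+ 2 + 2 * M)%:E)%E.
Proof.
move=> sf fM; rewrite ftildeE; case: ifPn => [le|_].
  rewrite l2sqE; last by apply: sqintB => //; exact: sqint_fring.
  rewrite lee_fin; apply: (le_trans (inner_sqB_le (sqint_fring _ _) sf)).
  rewrite lerD// ler_pM2l// fringE inner_tpoly (le_trans _ le)//.
rewrite l2sqE; last by apply: sqintB => //; exact: sqint_cst.
rewrite lee_fin (eq_inner (g' := f) (h' := f)); last by move=> t _; ring.
apply: (le_trans fM).
have := inner_ge0 f; have := sqr_ge0 (size s)%:R; nra.
Qed.

(** When the estimator is kept, Pythagoras gives the squared bias plus the coefficient error [D].
    When it is cut to 0, the loss is the squared bias plus [A], the squared norm of the projection;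
    either [A <= D], or the cut forces the squared sample size below [4 * A], and the last term
    pays. *)
Lemma ftilde_l2sq_coercive_le m s f (M c : R) : sqint f -> inner f f <= M ->
  (0 < size s)%N -> 0 < c -> coercive m s c ->
  (l2sq (fun t => ftilde m [seq obs z | z <- s] t - f t)%R <=
    ((1 + 2 * c ^- 2) * inner (fun t => fproj f m t - f t) (fun t => fproj f m t - f t) +
    2 * c ^- 2 * \sum_(i < 2 * m + 1) ((size s)%:R^-1 * \sum_(z <- s) noise f i z) ^+ 2
    + 4 * M ^+ 2 / (size s)%:R)%:E)%E.
Proof.
move=> sf fM s0 c0 cG; have := fring_coef_dist sf c0 cG.
set n := (size s)%:R; set e := inner (fun t => fproj f m t - f t) _.
set V := \sum_(i < _) (_ * _) ^+ 2; set D := \sum_i _ => DV.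
have n1 : 1 <= n :> R by rewrite ler1n.
have n0 : 0 < n by rewrite (lt_le_trans _ n1).
have eE : e = inner f f - \sum_(i < 2 * m + 1) inner f (@phi R i) ^+ 2.
  exact: inner_sqB_fproj.
suff : (l2sq (fun t => ftilde m [seq obs z | z <- s] t - f t)%R <=
    (e + D + 4 * M ^+ 2 / n)%:E)%E.
  move=> /le_trans; apply; rewrite lee_fin lerD2r.
  have -> : (1 + 2 * c ^- 2) * e + 2 * c ^- 2 * V = e + c ^- 2 * (2 * e + 2 * V).
    by ring.
  by rewrite lerD2l.
have rest0 : 0 <= 4 * M ^+ 2 / n by rewrite divr_ge0 ?(ltW n0)// mulr_ge0// sqr_ge0.
rewrite ftildeE -/n; case: ifPn => [_|].
  rewrite l2sqE; last by apply: sqintB => //; exact: sqint_fring.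
  rewrite lee_fin fringE inner_sqB_tpoly// -eE.
  by rewrite -/D lerDl.
rewrite -ltNge => big.
rewrite l2sqE; last by apply: sqintB => //; exact: sqint_cst.
rewrite lee_fin (eq_inner (g' := f) (h' := f)); last by move=> t _; ring.
set A := \sum_(i < 2 * m + 1) inner f (@phi R i) ^+ 2 in eE.
have AM : A <= M by apply: le_trans fM; exact: bessel.
have A0 : 0 <= A by apply: sumr_ge0 => i _; exact: sqr_ge0.
have -> : inner f f = e + A by rewrite eE subrK.
rewrite -addrA lerD2l; have [AD|DA] := leP A D; first lra.
(* Otherwise [n ^+ 2 < 4 * M], so that the term [4 * M ^+ 2 / n] exceeds [M]. *)
have nA : n ^+ 2 < 4 * A.
  apply: (lt_le_trans big); apply: (@le_trans _ _ (2 * D + 2 * A)); last lra.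
  rewrite /D /A !mulr_sumr -big_split; apply: ler_sum => i _ /=.
  move: (fring_coef m s i 0) (inner f (@phi R i)) => x y.
  have := sqr_ge0 (x - 2 * y); nra.
have D0 : 0 <= D by apply: sumr_ge0 => i _; exact: sqr_ge0.
suff : A <= 4 * M ^+ 2 / n by lra.
rewrite ler_pdivlMr//; nra.
Qed.

End ErrorDecomposition.

(** * From hits of grid cells to coercivity *)

Section Grid.
Context {R : realType}.
Notation Z := (R * (R * R))%type.
Notation leb := (@lebesgue_measure R).
Implicit Types (s : seq Z) (p : R * R) (t : R) (N k : nat).

Definition gridpt N k : R := 2 * pi * k%:R / N%:R.

Definition incell N k t : bool := gridpt N k <= t < gridpt N k.+1.

Lemma gridptS N k : (0 < N)%N -> gridpt N k.+1 = gridpt N k + 2 * pi / N%:R.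
Proof.
move=> N0; rewrite /gridpt -natr1; move: (pi : R) => p.
by field; rewrite pnatr_eq0 -lt0n.
Qed.

Lemma le_gridpt N k l : (k <= l)%N -> gridpt N k <= gridpt N l.
Proof.
move=> kl; rewrite /gridpt ler_wpM2r ?invr_ge0// ler_wpM2l ?ler_nat//.
exact/ltW/twopi_gt0.
Qed.

Lemma gridpt0 N : gridpt N 0 = 0.
Proof. by rewrite /gridpt mulr0 mul0r. Qed.

Lemma gridptN N : (0 < N)%N -> gridpt N N = 2 * pi.
Proof. by move=> N0; rewrite /gridpt mulfK// pnatr_eq0 -lt0n. Qed.

Lemma incell_circle N k t : (k < N)%N -> incell N k t -> circle t.
Proof.
move=> kN /andP[kt tk]; apply/circleE; apply/andP; split.
  by rewrite (le_trans _ kt)// -(gridpt0 N) le_gridpt.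
by rewrite (lt_le_trans tk)// -(@gridptN N) ?le_gridpt// (leq_ltn_trans _ kN).
Qed.

Lemma circle_incell N t : (0 < N)%N -> circle t -> exists2 k, (k < N)%N & incell N k t.
Proof.
move=> N0 /circleE/andP[t0 t2].
have tp := @twopi_gt0 R; have Nr : 0 < N%:R :> R by rewrite ltr0n.
pose x := t * N%:R / (2 * pi).
have x0 : 0 <= x by rewrite divr_ge0 ?(ltW tp)// mulr_ge0// ltW.
exists (Num.truncn x).
  by rewrite truncn_lt_nat// ltr_pdivrMr// mulrC ltr_pM2l.
have /andP[a b] := truncn_itv x0.
move: a b; rewrite /x ler_pdivlMr// ltr_pdivrMr// => a b.
by rewrite /incell /gridpt ler_pdivrMr// ltr_pdivlMr// mulrC a (mulrC _ _.+1%:R).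
Qed.

Definition cellI N k t : R := if incell N k t then 1 else 0.

Lemma measurable_incell d (T : measurableType d) (t : T -> R) N k :
  measurable_fun setT t -> measurable_fun setT (fun x => incell N k (t x)).
Proof.
move=> mt; apply: measurable_and.
  by apply: measurable_fun_ler => //; exact: measurable_cst.
by apply: measurable_fun_ltr => //; exact: measurable_cst.
Qed.

Lemma sqint_cellI N k h : sqint h -> sqint (fun t => cellI N k t * h t).
Proof.
apply: (@sqint_mulb _ _ _ 1) => [|t _]; last first.
  by rewrite /cellI; case: ifP; rewrite ?normr1 ?normr0.
apply: measurable_funTS; apply: measurable_fun_ifT; try exact: measurable_cst.
by apply: measurable_incell; exact: measurable_id.
Qed.

Lemma inner_cellI1 N k : (0 < N)%N -> (k < N)%N ->
  inner (fun t => cellI N k t * 1) (fun=> 1) = 2 * pi / N%:R.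
Proof.
move=> N0 kN; rewrite /inner.
transitivity (\int[leb]_(t in @circle R `&` [set` `[gridpt N k, gridpt N k.+1[%R]) (1 : R)).
  rewrite Rintegral_mkcondr; apply: eq_Rintegral => t _.
  rewrite !mulr1 patchE /cellI; case: ifPn => kt.
    by rewrite ifT// inE /= in_itv.
  by rewrite ifF//; apply/negbTE; rewrite notin_setE /= in_itv; exact/negP.
have -> : @circle R `&` [set` `[gridpt N k, gridpt N k.+1[%R] = [set` `[gridpt N k, gridpt N k.+1[%R].
  apply/setIidr => t /=; rewrite in_itv /= => kt; exact: incell_circle kN kt.
rewrite Rintegral_cst//= mul1r.
have d0 : gridpt N k < gridpt N k.+1.
  by rewrite gridptS// ltrDl divr_gt0 ?twopi_gt0 ?ltr0n.
transitivity (fine ((2 * pi / N%:R)%:E : \bar R)) => //; congr fine.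
transitivity (leb [set` `[gridpt N k, gridpt N k.+1[%R]) => //.
rewrite lebesgue_measure_itv /= lte_fin d0 -EFinB gridptS//; congr EFin; ring.
Qed.

Definition hitcell N k p : bool :=
  arc_mem p.1 p.2 (gridpt N k) && ~~ incell N k p.2.

(** Going anticlockwise from the left end of the cell, the arc can only be left past [p.2], which is
    not in the cell. For an arc through 0, either [p.1] precedes the left end and every later point
    of the circle is in the arc, or the left end precedes [p.2], which then lies beyond the cell. *)
Lemma hitcell_arc N k p t : hitcell N k p -> incell N k t -> circle t ->
  arc_mem p.1 p.2 t.
Proof.
move=> /andP[/andP[_ arc] p2] /andP[kt tk] /circleE t02.
rewrite /arc_mem t02 /=; move: arc p2; rewrite /incell negb_and -ltNge -leNgt.
case: ifP => _ /=.
  by move=> /andP[p1k kp2] /orP[|p2]; rewrite ?ltNge ?kp2//; apply/andP; split; lra.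
move=> /orP[p1k _|kp2 /orP[|p2]]; rewrite ?ltNge ?kp2//; apply/orP.
  by left; lra.
by right; lra.
Qed.

(** On good cells [meanarc s] is at least [s0 / 8]; on the others only nonnegativity is known. There
    are at most [2 / s0] of these, each carrying at most a fraction [2 * d / N] of the squared norm,
    so the assumption on [N] leaves at least half of it, whence [s0 / 16]. *)
Lemma coercive_hitcell m s N (good : pred nat) (s0 : R) :
  0 < s0 -> (0 < size s)%N -> (0 < N)%N ->
  8 * (2 * m + 1)%:R <= s0 * N%:R ->
  s0 * (\sum_(k < N | ~~ good k) 1) <= 2 ->
  (forall k, (k < N)%N -> good k ->
     s0 / 8 * (size s)%:R <= \sum_(z <- s) (if hitcell N k z.2 then 1 else 0)) ->
  coercive m s (s0 / 16).
Proof.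
move=> s00 n0 N0 hN bad hit v; set d := (2 * m + 1)%N in v hN *.
pose T := tpoly v; have sT : sqint T by exact: sqint_tpoly.
set A := \sum_i v i ^+ 2.
have A0 : 0 <= A by apply: sumr_ge0 => i _; exact: sqr_ge0.
have TT : inner T T = A.
  by rewrite inner_tpoly; apply: eq_bigr => i _; rewrite expr2.
have nr : 0 < (size s)%:R :> R by rewrite ltr0n.
pose badI t : R := \sum_(k < N | ~~ good k) cellI N k t.
have cI0 k t : 0 <= cellI N k t by rewrite /cellI; case: ifP.
have low t : circle t -> s0 / 8 * (1 - badI t) <= meanarc s t.
  move=> ct; have [k kN tk] := circle_incell N0 ct.
  have b0 : 0 <= badI t by apply: sumr_ge0.
  have [gk|bk] := boolP (good k).
    apply: (@le_trans _ _ (s0 / 8)).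
      by rewrite ler_piMr ?divr_ge0 ?(ltW s00)// gerBl.
    rewrite /meanarc [leRHS]mulrC ler_pdivlMr//; apply: (le_trans (hit k kN gk)).
    apply: ler_sum => z _; rewrite /arcI; case: ifP => // hz.
      by rewrite (hitcell_arc hz).
    by case: ifP.
  apply: le_trans (meanarc_ge0 _ _); rewrite pmulr_rle0 ?divr_gt0// subr_le0.
  rewrite /badI (bigD1 (Ordinal kN))//= /cellI tk lerDl.
  by apply: sumr_ge0 => i _; case: ifP.
have sbadT : sqint (fun t => badI t * T t).
  have -> : (fun t => badI t * T t) = (fun t => \sum_(k < N | ~~ good k) cellI N k t * T t).
    by apply/funext => t; rewrite mulr_suml.
  under eq_fun do rewrite -big_filter.
  by apply: sqint_sum => k; exact: sqint_cellI.
have badT : inner (fun t => badI t * T t) T <= A / 2.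
  have -> : inner (fun t => badI t * T t) T =
      \sum_(k < N | ~~ good k) inner (fun t => cellI N k t * T t) T.
    rewrite -big_filter -inner_suml//; last by move=> k; exact: sqint_cellI.
    by apply: eq_inner => t _; rewrite big_filter -mulr_suml.
  (* The sup bound of the squared polynomial times the length of a cell. *)
  pose B := A * (d%:R / pi) * (2 * pi / N%:R).
  have cellB k : (k < N)%N -> inner (fun t => cellI N k t * T t) T <= B.
    move=> kN; rewrite /B -(inner_cellI1 N0 kN) -innerZl; try exact: sqint_cst; last first.
      by apply: sqint_cellI; exact: sqint_cst.
    apply: le_inner => //; try exact: sqint_cst; try exact: sqint_cellI.
      by apply: sqintZ; apply: sqint_cellI; exact: sqint_cst.
    move=> t _; rewrite -mulrA -expr2 /cellI; case: ifP => _.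
      by rewrite !mulr1 mul1r; exact: tpoly_sqr_le.
    by rewrite !mul0r mulr0 mul0r.
  apply: (@le_trans _ _ (\sum_(k < N | ~~ good k) B)).
    by apply: ler_sum => k _; exact: cellB.
  have -> : \sum_(k < N | ~~ good k) B = (\sum_(k < N | ~~ good k) 1) * B.
    by rewrite mulr_suml; apply: eq_bigr => k _; rewrite mul1r.
  have -> : B = A * (2 * d%:R / N%:R).
    have Nn : N%:R != 0 :> R by rewrite pnatr_eq0 -lt0n.
    rewrite /B; have := @pi_gt0 R; move: (pi : R) (d%:R : R) (N%:R : R) Nn => p d' N' Nn p0.
    by field; rewrite Nn gt_eqF.
  rewrite mulrCA ler_wpM2l//; move: bad; set c := \sum_(k < N | _) 1 => bad.
  have Nr : 0 < N%:R :> R by rewrite ltr0n.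
  rewrite mulrA ler_pdivrMr//.
  have d0 : 0 <= d%:R :> R by [].
  rewrite -(ler_pM2l s00).
  have := ler_wpM2r d0 bad; nra.
apply: (@le_trans _ _ (inner (fun t => s0 / 8 * (T t - badI t * T t)) T)); last first.
  apply: le_inner => //; last 1 first.
  - move=> t ct; have := ler_wpM2r (sqr_ge0 (T t)) (low t ct).
    by rewrite -/T expr2; congr (_ <= _); ring.
  - by apply: sqintZ; exact: sqintB.
  - exact: sqint_meanarc.
rewrite innerZl ?innerBl//; last exact: sqintB.
rewrite TT; nra.
Qed.

End Grid.

(** * Hit probabilities of cells and monotonicity of the iterated expectation *)

Section Sampling.
Context {R : realType}.
Notation Z := (R * (R * R))%type.
Notation leb := (@lebesgue_measure R).
Implicit Types (mu : {measure set (R * R)%type -> \bar R}) (f : R -> R) (N k : nat).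

Lemma measurable_setb d (T : measurableType d) (b : T -> bool) :
  measurable_fun setT b -> measurable [set x | b x].
Proof.
move=> mb; have := mb measurableT [set true] I; rewrite setTI.
by congr measurable; apply/seteqP; split => x.
Qed.

Lemma measurable_incell2 N k : measurable [set p : R * R | incell N k p.2].
Proof. by apply: measurable_setb; apply: measurable_incell; exact: measurable_snd. Qed.

Lemma measurable_hitcell N k : measurable [set p : R * R | hitcell N k p].
Proof.
apply: measurable_setb; apply: measurable_and.
  apply: measurable_arc_mem; [exact: measurable_fst|exact: measurable_snd|].
  exact: measurable_cst.
by apply: measurable_neg; apply: measurable_incell; exact: measurable_snd.
Qed.

(** The cells are disjoint: by induction the first [j] of them make up the event [U j]. *)
Lemma sum_measure_cells mu N : mu setT = 1%E ->
  (\sum_(k < N) mu [set p | incell N k p.2] <= 1)%E.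
Proof.
move=> mu1.
pose U k := [set p : R * R | (0 <= p.2) && (p.2 < gridpt N k)].
have mU k : measurable (U k).
  apply: measurable_setb; apply: measurable_and.
    by apply: measurable_fun_ler; [exact: measurable_cst|exact: measurable_snd].
  by apply: measurable_fun_ltr; [exact: measurable_snd|exact: measurable_cst].
have sumU j : (\sum_(k < j) mu [set p | incell N k p.2] = mu (U j))%E.
  elim: j => [|k IH].
    rewrite big_ord0 [U 0%N](_ : _ = set0) ?measure0//.
    apply/seteqP; split => p //; rewrite /U /= gridpt0 => /andP[a b].
    by have := le_lt_trans a b; rewrite ltxx.
  rewrite big_ord_recr /= IH -measureU//; last 2 first.
  - exact: measurable_incell2.
  - by apply/seteqP; split => p //= -[/andP[_ p2] /andP[]]; rewrite leNgt p2.
  congr (mu _); apply/seteqP; split => p /=.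
    have := @le_gridpt R N _ _ (leqnSn k); have := @le_gridpt R N _ _ (leq0n k).
    rewrite gridpt0 /incell => a b [/andP[c d]|/andP[c d]]; apply/andP; split; lra.
  move=> /andP[p0 pk]; have [a|a] := ltP p.2 (gridpt N k).
    by left; rewrite /U /= p0.
  by right; rewrite /incell a.
by rewrite sumU -mu1 le_measure ?inE.
Qed.

(** The threshold is half of the coverage probability, so that the other half is left for
    [hitcell]. *)
Definition goodcell mu N (s0 : R) k : bool :=
  (mu [set p | incell N k p.2] <= (s0 / 2)%:E)%E.

(** Each exceptional cell takes more than [s0 / 2] of a total mass at most 1, so the count is
    bounded independently of [N]. *)
Lemma badcell_count mu N (s0 : R) : mu setT = 1%E -> 0 < s0 ->
  s0 * (\sum_(k < N | ~~ goodcell mu N s0 k) 1) <= 2.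
Proof.
move=> mu1 s00.
suff : ((\sum_(k < N | ~~ goodcell mu N s0 k) (s0 / 2))%:E <= 1 :> \bar R)%E.
  rewrite lee_fin; under eq_bigr do rewrite -[s0 / 2]mulr1.
  by rewrite -mulr_sumr; lra.
apply: le_trans (@sum_measure_cells mu N mu1).
rewrite -sumEFin.
apply: (@le_trans _ _ (\sum_(k < N | ~~ goodcell mu N s0 k) mu [set p | incell N k p.2])%E).
  by apply: lee_sum => k; rewrite /goodcell -ltNge => /ltW.
rewrite [leRHS](bigID (fun k : 'I_N => goodcell mu N s0 k)) /= leeDr//.
exact: sume_ge0.
Qed.

(** Of the event that the arc contains the left end, only the part where the upper end is in the
    cell is lost; on a good cell it weighs at most [s0 / 2]. *)
Lemma hitcell_measure_ge mu N (s0 : R) k : mu setT = 1%E ->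
  (s0%:E <= sigma mu (gridpt N k))%E -> goodcell mu N s0 k ->
  ((s0 / 2)%:E <= mu [set p | hitcell N k p])%E.
Proof.
move=> mu1 s0k gk.
have : (s0%:E <= mu [set p | hitcell N k p] + (s0 / 2)%:E)%E.
  apply: (le_trans s0k); apply: (@le_trans _ _
    (mu ([set p | hitcell N k p] `|` [set p | incell N k p.2]))).
    apply: le_measure; rewrite ?inE.
    - apply: measurable_setb; apply: measurable_arc_mem;
        [exact: measurable_fst|exact: measurable_snd|exact: measurable_cst].
    - by apply: measurableU; [exact: measurable_hitcell|exact: measurable_incell2].
    - move=> p /= ap; rewrite /hitcell ap /=.
      by case: (boolP (incell N k p.2)); [right|left].
  apply: (le_trans (measureU2 _ _ _)); [exact: measurable_hitcell|exact: measurable_incell2|].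
  by rewrite leeD2l.
by rewrite -leeBlDr// -EFinB (_ : s0 - s0 / 2 = s0 / 2)//; field.
Qed.

(* Since [expR (- 1) <= 2^-1], products of [halfhit] majorize the exponential
   weights of the Chernoff bound for the number of hits of a cell. *)
Definition halfhit N k (p : R * R) : R := if hitcell N k p then 2^-1 else 1.

Lemma halfhit_ge0 N k p : 0 <= halfhit N k p.
Proof. by rewrite /halfhit; case: ifP. Qed.

Lemma measurable_halfhit N k : measurable_fun setT (halfhit N k).
Proof.
apply: measurable_fun_ifT; try exact: measurable_cst.
apply: measurable_and.
  apply: measurable_arc_mem; [exact: measurable_fst|exact: measurable_snd|].
  exact: measurable_cst.
by apply: measurable_neg; apply: measurable_incell; exact: measurable_snd.
Qed.

(** [halfhit] is one half plus half of the indicator of a miss, so its mean is one minus half of the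
    hit probability. *)
Lemma integral_halfhit_le mu N (s0 : R) k : mu setT = 1%E ->
  ((s0 / 2)%:E <= mu [set p | hitcell N k p])%E ->
  (\int[mu]_p (halfhit N k p)%:E <= (1 - s0 / 4)%:E)%E.
Proof.
move=> mu1 hA; set A := [set p | hitcell N k p] in hA *.
have mA : measurable A by exact: measurable_hitcell.
have -> : (\int[mu]_p (halfhit N k p)%:E =
    \int[mu]_p ((2^-1)%:E + (2^-1)%:E * (\1_(~` A) p)%:E))%E.
  apply: eq_integral => p _; rewrite -EFinM -EFinD /halfhit indicE in_setC.
  case: ifPn => hp; congr EFin.
    by rewrite (_ : (p \notin A) = false) ?mulr0 ?addr0//; apply/negbTE; rewrite negbK inE.
  have pA : p \notin A by rewrite notin_setE; exact/negP.
  rewrite pA.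
  by rewrite mulr1; field.
have mI : measurable_fun setT (\1_(~` A) : R * R -> R).
  by apply: measurable_indic; exact: measurableC.
rewrite ge0_integralD//; last first.
  by apply/measurable_EFinP; apply: measurable_funM => //; exact: measurable_cst.
rewrite integral_cst// [mu setT]mu1 mule1 ge0_integralZl//; last exact/measurable_EFinP.
rewrite integral_indic ?setIT//; last exact: measurableC.
have fA : mu A \is a fin_num.
  rewrite ge0_fin_numE//; apply: (@le_lt_trans _ _ (mu setT)); last by rewrite mu1 ltry.
  by rewrite le_measure ?inE.
have -> : mu (~` A) = (1 - mu A)%E.
  rewrite -mu1 -(setvU A) measureU//; [|exact: measurableC|exact: setICl].
  by rewrite addeK.
move: hA fA; case: (mu A) => //= r; rewrite lee_fin => hA _.
by rewrite -EFinB -EFinM -EFinD lee_fin; lra.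
Qed.

(* The integral of a nonnegative function is a supremum over the simple functions
   below it, so the risk can be bounded without the measurability of the
   estimator in the sample. *)
Lemma ge0_le_integral_nomeas d (T : measurableType d) (nu : {measure set T -> \bar R})
    (D : set T) (g h : T -> \bar R) :
  (forall x, D x -> (0 <= g x)%E) -> (forall x, D x -> (g x <= h x)%E) ->
  (\int[nu]_(x in D) g x <= \int[nu]_(x in D) h x)%E.
Proof.
move=> g0 gh.
have h0 x : D x -> (0 <= h x)%E by move=> Dx; apply: le_trans (gh _ Dx); exact: g0.
rewrite !ge0_integralE//; apply: ereal_sup_le => y [u ug <-].
exists u => // x.
apply: (le_trans (ug x)); rewrite !patchE; case: ifPn => // /[!inE]; exact: gh.
Qed.

Lemma iexp_ge0 f mu n (g : seq Z -> \bar R) : (forall x, circle x -> 0 <= f x) ->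
  (forall s, (0 <= g s)%E) -> (0 <= iexp f mu n g)%E.
Proof.
move=> f0; elim: n g => [|n IH] g g0 /=; first exact: g0.
apply: integral_ge0 => x cx; apply: mule_ge0; first by rewrite lee_fin f0.
by apply: integral_ge0 => p _; exact: IH.
Qed.

Lemma le_iexp f mu n (g h : seq Z -> \bar R) : (forall x, circle x -> 0 <= f x) ->
  (forall s, (0 <= g s)%E) -> (forall s, size s = n -> (g s <= h s)%E) ->
  (iexp f mu n g <= iexp f mu n h)%E.
Proof.
move=> f0; elim: n g h => [|n IH] g h g0 gh /=; first exact: gh.
apply: ge0_le_integral_nomeas => x cx.
  apply: mule_ge0; first by rewrite lee_fin f0.
  by apply: integral_ge0 => p _; exact: iexp_ge0.
apply: lee_wpmul2l; first by rewrite lee_fin f0.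
apply: ge0_le_integral_nomeas => p _; first exact: iexp_ge0.
by apply: IH => // s sn; apply: gh; rewrite /= sn.
Qed.

End Sampling.

(** * Moments of the noise and integration over successive draws *)

Section Risk.
Context {R : realType}.
Notation Z := (R * (R * R))%type.
Notation leb := (@lebesgue_measure R).
Implicit Types (mu : {measure set (R * R)%type -> \bar R}) (f : R -> R) (N k : nat).

Lemma tonelli_lebesgue mu (G : R * (R * R) -> \bar R) : mu setT = 1%E ->
  measurable_fun setT G -> (forall z, (0 <= G z)%E) ->
  (\int[leb]_x \int[mu]_p G (x, p) = \int[mu]_p \int[leb]_x G (x, p))%E.
Proof.
move=> mu1 mG G0.
have muoo : (mu setT < +oo)%E by rewrite mu1 ltry.
(* [mu] is finite only by hypothesis; [nu] is the same measure equipped as a finite one, ready for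
   Tonelli's theorem. *)
pose nu := mfrestr measurableT muoo.
have E (g : R * R -> \bar R) : (\int[mu]_p g p = \int[nu]_p g p)%E.
  by apply: eq_measure_integral => A mA _; rewrite -[in LHS](setIT A).
rewrite E; under eq_integral do rewrite E.
exact: (@fubini_tonelli _ _ (measurableTypeR R) (R * R)%type R leb nu G).
Qed.

(** [iexp] integrates over [x] outside and over [p] inside, whereas the noise is centred in [x] for
    fixed [p]: the order has to be exchanged. *)
Lemma tonelli_density f mu (G : R * (R * R) -> R) : mu setT = 1%E ->
  measurable_fun (@circle R) f -> (forall x, circle x -> 0 <= f x) ->
  measurable_fun setT G -> (forall z, 0 <= G z) ->
  (\int[leb]_(x in @circle R) ((f x)%:E * \int[mu]_p (G (x, p))%:E) =
   \int[mu]_p \int[leb]_(x in @circle R) (f x * G (x, p))%:E)%E.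
Proof.
move=> mu1 mf f0 mG G0.
pose g := f \_ (@circle R).
have mg : measurable_fun setT g.
  by apply/(measurable_restrictT _ _).1 => //; exact: measurable_circle.
have g0 x : 0 <= g x.
  by rewrite /g patchE; case: ifPn => // /[!inE]; exact: f0.
pose F (z : R * (R * R)) := (g z.1 * G z)%:E.
have mF : measurable_fun setT F.
  apply/measurable_EFinP; apply: measurable_funM => //.
  by apply: measurableT_comp mg _; exact: measurable_fst.
have F0 z : (0 <= F z)%E by rewrite lee_fin mulr_ge0.
have mGx x : measurable_fun setT (fun p => G (x, p)).
  by apply: measurableT_comp mG _; exact: measurable_pair1.
transitivity (\int[leb]_x \int[mu]_p F (x, p))%E; last first.
  rewrite tonelli_lebesgue//; apply: eq_integral => p _.
  rewrite [RHS]integral_mkcond; apply: eq_integral => x _.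
  by rewrite /F /g /= !patchE; case: ifPn => //; rewrite mul0r.
rewrite integral_mkcond; apply: eq_integral => x _.
rewrite /F /g /= !patchE; case: ifPn => [/[!inE] cx|_]; last first.
  by rewrite integral0_eq// => p _; rewrite mul0r.
rewrite -ge0_integralZl_EFin//; last 3 first.
- by move=> p _; rewrite lee_fin.
- exact/measurable_EFinP.
- exact: f0.
Qed.

Lemma measurable_inner_arcI f (h : R -> R) :
  measurable_fun (@circle R) f -> (forall x, circle x -> 0 <= f x) ->
  measurable_fun setT h -> (forall x, 0 <= h x) ->
  measurable_fun setT (fun p => inner (fun t => arcI p t * f t) h).
Proof.
move=> mf f0 mh h0.
pose g := f \_ (@circle R).
have mg : measurable_fun setT g.
  by apply/(measurable_restrictT _ _).1 => //; exact: measurable_circle.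
have g0 x : 0 <= g x.
  by rewrite /g patchE; case: ifPn => // /[!inE]; exact: f0.
pose F (z : R * (R * R)) := (arcI z.2 z.1 * g z.1 * h z.1)%:E.
have mF : measurable_fun setT F.
  apply/measurable_EFinP; apply: measurable_funM.
    apply: measurable_funM.
      by apply: measurable_arcI; [exact: measurable_snd|exact: measurable_fst].
    by apply: measurableT_comp mg _; exact: measurable_fst.
  by apply: measurableT_comp mh _; exact: measurable_fst.
have F0 z : (0 <= F z)%E by rewrite lee_fin !mulr_ge0// arcI_ge0.
have -> : (fun p => inner (fun t => arcI p t * f t) h) =
    fine \o (fun p => \int[leb]_x F (x, p))%E.
  apply/funext => p /=; rewrite /inner /Rintegral integral_mkcond; congr fine.
  apply: eq_integral => x _; rewrite /F /g /= !patchE; case: ifPn => //.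
  by rewrite mulr0 mul0r.
apply: measurableT_comp; first exact: fine_measurable.
exact: (@measurable_fun_fubini_tonelli_G _ _ (measurableTypeR R) (R * R)%type R leb F).
Qed.

Lemma measurable_noise f i : sqint f -> (forall x, circle x -> 0 <= f x) ->
  measurable_fun setT (noise f i).
Proof.
move=> sf f0; have mf := sf.1.
apply: measurable_funB.
  apply: measurable_funM.
    by apply: measurable_arcI; [exact: measurable_snd|exact: measurable_fst].
  by apply: measurableT_comp (@measurable_phi R i) _; exact: measurable_fst.
(* [measurable_inner_arcI] rests on Tonelli and wants a nonnegative factor, so [phi i] is shifted by
   1 and the shift is subtracted afterwards. *)
have m1 : measurable_fun setT (fun t : R => phi i t + 1).
  by apply: measurable_funD; [exact: measurable_phi|exact: measurable_cst].
have E : (fun p : R * R => inner (fun t => arcI p t * f t) (@phi R i)) =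
   (fun p => inner (fun t => arcI p t * f t) (fun t => phi i t + 1) -
             inner (fun t => arcI p t * f t) (fun=> 1)).
  apply/funext => p; rewrite -innerBr; last 3 first.
  - exact: sqint_arcI.
  - by apply: sqintD; [exact: sqint_phi|exact: sqint_cst].
  - exact: sqint_cst.
  by apply: eq_inner => t _; rewrite addrK.
have m2 : measurable_fun setT (fun p : R * R => inner (fun t => arcI p t * f t) (@phi R i)).
  rewrite E; apply: measurable_funB; apply: measurable_inner_arcI => //.
  by move=> x; have := phi_norm_le i x; rewrite ler_norml => /andP[]; lra.
by apply: measurableT_comp m2 _; exact: measurable_snd.
Qed.

Lemma sqint_arcI_phi p i : sqint (fun x => arcI p x * @phi R i x).
Proof. by apply: sqint_arcI; exact: sqint_phi. Qed.

Lemma sqint_noise_sqr f p i (u : R) : sqint (fun x => (u + noise f i (x, p)) ^+ 2).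
Proof.
have s1 : sqint (fun x => u + noise f i (x, p)).
  apply: sqintD; first exact: sqint_cst.
  exact: (sqintB (sqint_arcI_phi p i) (sqint_cst (inner (fun t => arcI p t * f t) (@phi R i)))).
apply: (sqint_mulb (c := `|u| + (1 + `|inner (fun t => arcI p t * f t) (@phi R i)|)) _ _ s1).
  by have [] := s1.
move=> x _; apply: (le_trans (ler_normD _ _)); rewrite lerD2l.
apply: (le_trans (ler_normB _ _)); rewrite lerD2r normrM.
by rewrite mulr_ile1// ?arcI_norm ?phi_norm_le.
Qed.

(** Under the density [f] the noise has mean 0 for fixed [p], so the cross term with [u] disappears
    and only a second moment is added. The latter is bounded through the size of [phi i] and the
    total mass 1, without the sup norm of [f], which is why [C2] depends on [sigma0] only. *)
Lemma inner_noise_sqr_le f p i (u : R) : sqint f ->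
  (forall x, circle x -> 0 <= f x) -> inner f (fun=> 1) = 1 ->
  inner f (fun x => (u + noise f i (x, p)) ^+ 2) <= u ^+ 2 + pi^-1.
Proof.
move=> sf f0 f1; pose b x := arcI p x * @phi R i x.
pose g := inner (fun t => arcI p t * f t) (@phi R i).
have sb : sqint b by exact: sqint_arcI_phi.
have b2 x : b x ^+ 2 <= pi^-1.
  rewrite /b exprMn; apply: le_trans (phi_sqr_le i x).
  by rewrite ler_piMl ?sqr_ge0// expr_le1 ?arcI_le1 ?arcI_ge0.
have sb2 : sqint (fun x => b x * b x).
  apply: (sqint_mulb (c := 1) _ _ sb); first by have [] := sb.
  by move=> x _; rewrite normrM mulr_ile1// ?arcI_norm ?phi_norm_le.
have gE : inner f b = g.
  by apply: eq_inner => t _; rewrite /b mulrA (mulrC (f t)).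
have fb2 : inner f (fun x => b x * b x) <= pi^-1.
  rewrite -[leRHS]mul1r -f1 mulrC -innerZl//; last exact: sqint_cst.
  apply: le_inner => //; [exact: sqintZ|exact: sqint_cst|].
  by move=> x cx; rewrite mulr1 (mulrC _ (f x)) ler_wpM2l ?f0// -expr2.
have -> : inner f (fun x => (u + noise f i (x, p)) ^+ 2) =
    (u - g) ^+ 2 * inner f (fun=> 1) + (2 * (u - g) * inner f b + inner f (fun x => b x * b x)).
  rewrite !(innerC f) -!innerZl//; last exact: sqint_cst.
  rewrite -!innerDl//; last 3 first.
  - by apply: sqintZ; exact: sqint_cst.
  - by apply: sqintD => //; exact: sqintZ.
  - exact: sqintZ.
  apply: eq_inner => x _; congr (_ * _); rewrite /noise /= -/g -/(b x); ring.
rewrite f1 gE; have := sqr_ge0 g; nra.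
Qed.

Lemma density_inner1 f : is_density f -> inner f (fun=> 1) = 1.
Proof.
move=> [_ [_ f1]]; rewrite /inner /Rintegral.
by under eq_integral do rewrite mulr1; rewrite f1.
Qed.

(** The alternative [w k = 0] is for exceptional cells, where the mean of [halfhit] has no useful
    bound. *)
Lemma integral_halfhit_sum_le mu N (rho C : R) (w : 'I_N -> R) : mu setT = 1%E ->
  0 <= C -> (forall k : 'I_N, 0 <= w k) ->
  (forall k : 'I_N, w k = 0 \/ (\int[mu]_p (halfhit N k p)%:E <= rho%:E)%E) ->
  (\int[mu]_p (C + \sum_(k < N) w k * halfhit N k p)%:E <=
   (C + \sum_(k < N) w k * rho)%:E)%E.
Proof.
move=> mu1 C0 w0 hw.
have mh k : measurable_fun setT (fun p : R * R => (halfhit N k p)%:E).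
  by apply/measurable_EFinP; exact: measurable_halfhit.
have mw (k : 'I_N) : measurable_fun setT (fun p => (w k * halfhit N k p)%:E).
  apply/measurable_EFinP; apply: measurable_funM; first exact: measurable_cst.
  exact: measurable_halfhit.
have hw0 (k : 'I_N) p : (0 <= (w k * halfhit N k p)%:E)%E.
  by rewrite lee_fin mulr_ge0// halfhit_ge0.
have -> : (\int[mu]_p (C + \sum_(k < N) w k * halfhit N k p)%:E =
    \int[mu]_p (C%:E + \sum_(k < N) (w k * halfhit N k p)%:E))%E.
  by apply: eq_integral => p _; rewrite EFinD sumEFin.
rewrite ge0_integralD//; last 2 first.
- by move=> p _; exact: sume_ge0.
- by apply: emeasurable_sum.
rewrite integral_cst// [mu setT]mu1 mule1 ge0_integral_sum// EFinD leeD2l//.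
rewrite -sumEFin; apply: lee_sum => k _.
under eq_integral do rewrite EFinM.
rewrite ge0_integralZl_EFin//; last first.
  by move=> p _; rewrite lee_fin halfhit_ge0.
have [->|hk] := hw k; first by rewrite mul0e mul0r.
by rewrite EFinM lee_wpmul2l// lee_fin.
Qed.

Lemma integral_inner g h : sqint g -> sqint h ->
  (\int[leb]_(x in @circle R) (g x * h x)%:E)%E = (inner g h)%:E.
Proof.
move=> sg sh; rewrite /inner /Rintegral fineK//.
by apply: integrable_fin_num; [exact: measurable_circle|exact: integrable_sqintM].
Qed.

Lemma density_step_le f d (c C : R) (u : 'I_d -> R) p : is_density f -> sqint f ->
  0 <= c ->
  (\int[leb]_(x in @circle R)
     (f x * (C + c * \sum_(i < d) (u i + noise f i (x, p)) ^+ 2))%:E <=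
   (C + c * \sum_(i < d) (u i ^+ 2 + pi^-1))%:E)%E.
Proof.
move=> df sf c0; have f1 := density_inner1 df; have [_ [f0 _]] := df.
have sS : sqint (fun x => \sum_(i < d) (u i + noise f i (x, p)) ^+ 2).
  by apply: sqint_sum => i; exact: sqint_noise_sqr.
have sC : sqint (fun _ : R => C * 1) by exact: sqint_cst.
rewrite (integral_inner (h := fun x => C + c * \sum_(i < d) (u i + noise f i (x, p)) ^+ 2) sf);
  last first.
  by apply: sqintD; [exact: sqint_cst|exact: sqintZ].
have -> : inner f (fun x => C + c * \sum_(i < d) (u i + noise f i (x, p)) ^+ 2) =
   C * inner f (fun=> 1) + c * \sum_(i < d) inner f (fun x => (u i + noise f i (x, p)) ^+ 2).
  rewrite -inner_sumr//; last by move=> i; exact: sqint_noise_sqr.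
  rewrite !(innerC f) -!innerZl//; last exact: sqint_cst.
  rewrite -innerDl//; last exact: sqintZ.
  by apply: eq_inner => x _; rewrite mulr1.
rewrite lee_fin f1 mulr1 lerD2l ler_wpM2l//; apply: ler_sum => i _.
exact: inner_noise_sqr_le.
Qed.

(* [u] and [w] carry the contribution of the part of the sample already drawn,
   so that the induction is on the number of remaining draws. *)
Lemma iexp_quadratic_le f mu d N (c rho : R) n :
  is_density f -> sqint f -> mu setT = 1%E -> 0 <= c -> 0 <= rho ->
  forall (K : R) (u : 'I_d -> R) (w : 'I_N -> R), 0 <= K -> (forall k : 'I_N, 0 <= w k) ->
  (forall k : 'I_N, w k = 0 \/ (\int[mu]_p (halfhit N k p)%:E <= rho%:E)%E) ->
  (iexp f mu n (fun s => (K + c * \sum_(i < d) (u i + \sum_(z <- s) noise f i z) ^+ 2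
      + \sum_(k < N) w k * \prod_(z <- s) halfhit N k z.2)%:E) <=
   (K + c * \sum_(i < d) (u i ^+ 2 + n%:R / pi) + \sum_(k < N) w k * rho ^+ n)%:E)%E.
Proof.
move=> df sf mu1 c0 rho0; have [mf [f0 f1]] := df.
elim: n => [|n IH] K u w K0 w0 hw /=.
  rewrite lee_fin !lerD//; last by apply: ler_sum => k _; rewrite big_nil expr0.
  by rewrite ler_wpM2l//; apply: ler_sum => i _; rewrite big_nil addr0 mul0r addr0.
(* The bound given by the induction hypothesis after a first draw [z], whose noise is added to [u]
   and whose hits are multiplied into [w]. Being explicit, it is measurable, as the exchange of
   integrals requires. *)
pose G (z : Z) := (K + c * \sum_(i < d) ((u i + noise f i z) ^+ 2 + n%:R / pi)
      + \sum_(k < N) (w k * halfhit N k z.2) * rho ^+ n).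
have mG : measurable_fun setT G.
  apply: measurable_funD.
    apply: measurable_funD; first exact: measurable_cst.
    apply: measurable_funM; first exact: measurable_cst.
    apply: measurable_sum => i; apply: measurable_funD; last exact: measurable_cst.
    apply: measurable_funX; apply: measurable_funD; first exact: measurable_cst.
    exact: measurable_noise.
  apply: measurable_sum => k; apply: measurable_funM; last exact: measurable_cst.
  apply: measurable_funM; first exact: measurable_cst.
  by apply: measurableT_comp (measurable_halfhit N k) _; exact: measurable_snd.
have G0 z : 0 <= G z.
  rewrite /G addr_ge0//; last first.
    by apply: sumr_ge0 => k _; rewrite !mulr_ge0// ?halfhit_ge0 ?exprn_ge0.
  rewrite addr_ge0// mulr_ge0//; apply: sumr_ge0 => i _.
  by rewrite addr_ge0 ?sqr_ge0// divr_ge0// pi_ge0.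
apply: (@le_trans _ _ (\int[leb]_(x in @circle R) ((f x)%:E * \int[mu]_p (G (x, p))%:E))%E).
  have H0 s (v : 'I_d -> R) (w' : 'I_N -> R) : (forall k : 'I_N, 0 <= w' k) ->
      (0 <= (K + c * \sum_(i < d) (v i + \sum_(z <- s) noise f i z) ^+ 2
      + \sum_(k < N) w' k * \prod_(z <- s) halfhit N k z.2)%:E)%E.
    move=> w'0; rewrite lee_fin addr_ge0//; last first.
      apply: sumr_ge0 => k _; rewrite mulr_ge0//.
      by apply: prodr_ge0 => z _; exact: halfhit_ge0.
    by rewrite addr_ge0// mulr_ge0//; apply: sumr_ge0 => i _; exact: sqr_ge0.
  have consE x p : (fun s : seq Z => (K + c * \sum_(i < d) (u i +
        \sum_(z <- (x, p) :: s) noise f i z) ^+ 2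
      + \sum_(k < N) w k * \prod_(z <- (x, p) :: s) halfhit N k z.2)%:E) =
    (fun s => (K + c * \sum_(i < d) ((u i + noise f i (x, p)) +
        \sum_(z <- s) noise f i z) ^+ 2
      + \sum_(k < N) (w k * halfhit N k p) * \prod_(z <- s) halfhit N k z.2)%:E).
    apply/funext => s; congr EFin; congr (_ + _ * _ + _).
      by apply: eq_bigr => i _; rewrite big_cons addrA.
    by apply: eq_bigr => k _; rewrite big_cons mulrA.
  have wh0 p (k : 'I_N) : 0 <= w k * halfhit N k p by rewrite mulr_ge0// halfhit_ge0.
  apply: ge0_le_integral_nomeas => x cx.
    apply: mule_ge0; first by rewrite lee_fin f0.
    apply: integral_ge0 => p _; rewrite consE; apply: iexp_ge0 => // s.
    exact: H0.
  apply: lee_wpmul2l; first by rewrite lee_fin f0.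
  apply: ge0_le_integral_nomeas => p _; rewrite consE.
    by apply: iexp_ge0 => // s; exact: H0.
  apply: IH => // k; have [->|hk] := hw k; first by left; rewrite mul0r.
  by right.
rewrite tonelli_density//.
pose C1 := K + c * \sum_(i < d) (u i ^+ 2 + n.+1%:R / pi).
have C10 : 0 <= C1.
  rewrite addr_ge0// mulr_ge0//; apply: sumr_ge0 => i _.
  by rewrite addr_ge0 ?sqr_ge0// divr_ge0// pi_ge0.
(* Integrating over [x] replaces the noise of the draw by [pi^-1], which raises [n] to [n.+1]; the
   hit factors depend on [p] alone. *)
apply: (@le_trans _ _ (\int[mu]_p (C1 + \sum_(k < N) (w k * rho ^+ n) * halfhit N k p)%:E)%E).
  apply: ge0_le_integral_nomeas => p _.
    by apply: integral_ge0 => x cx; rewrite lee_fin mulr_ge0// f0.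
  have := @density_step_le f d c (K + c * \sum_(i < d) (n%:R / pi)
     + \sum_(k < N) (w k * rho ^+ n) * halfhit N k p) u p df sf c0.
  move=> h.
  have EG x : f x * G (x, p) = f x * (K + c * \sum_(i < d) (n%:R / pi)
     + \sum_(k < N) (w k * rho ^+ n) * halfhit N k p
     + c * \sum_(i < d) (u i + noise f i (x, p)) ^+ 2).
    congr (_ * _); rewrite /G big_split /= mulrDr.
    have -> : \sum_(k < N) w k * halfhit N k p * rho ^+ n =
      \sum_(k < N) w k * rho ^+ n * halfhit N k p by apply: eq_bigr => k _; ring.
    by ring.
  under eq_integral do rewrite EG.
  apply: (le_trans h).
  have E : \sum_(i < d) (u i ^+ 2 + n.+1%:R / pi) =
      \sum_(i < d) (n%:R / pi) + \sum_(i < d) (u i ^+ 2 + pi^-1).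
    rewrite -big_split /=; apply: eq_bigr => i _.
    by rewrite -natr1 mulrDl mul1r addrCA.
  have regroup (a b q : R) : K + c * a + q + c * b <= K + c * (a + b) + q.
    by rewrite le_eqVlt; apply/orP; left; apply/eqP; ring.
  by rewrite lee_fin /C1 E regroup.
apply: (le_trans (integral_halfhit_sum_le (rho := rho) mu1 C10 _ _)).
- by move=> k; rewrite mulr_ge0// exprn_ge0.
- by move=> k; have [->|hk] := hw k; [left; rewrite mul0r|right].
rewrite lee_fin lerD2l; apply: ler_sum => k _.
by rewrite exprSr mulrA.
Qed.

End Risk.

(** * The oracle inequality *)

Section RiskBound.
Context {R : realType}.
Notation Z := (R * (R * R))%type.
Notation leb := (@lebesgue_measure R).
Implicit Types (mu : {measure set (R * R)%type -> \bar R}) (f : R -> R) (N k : nat).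

(** Almost everywhere [f ^+ 2 <= M * f], and [f] has mass 1. *)
Lemma density_sqint f (M : R) : is_density f -> 0 <= M -> Linf_bound f M ->
  sqint f /\ inner f f <= M.
Proof.
move=> [mf [f0 f1]] M0 fM.
have mE : measurable_fun (@circle R) (EFin \o f) by exact/measurable_EFinP.
have m2 : measurable_fun (@circle R) (EFin \o (fun t => f t ^+ 2)).
  by apply/measurable_EFinP; exact: measurable_funX.
have le2 : (\int[leb]_(t in @circle R) (f t ^+ 2)%:E <= M%:E)%E.
  rewrite -[leRHS]mule1 -f1 -ge0_integralZl_EFin//; last exact: measurable_circle.
  apply: ae_ge0_le_integral => //.
  - exact: measurable_circle.
  - by move=> t _; rewrite lee_fin sqr_ge0.
  - by move=> t ct; rewrite mule_ge0 ?lee_fin ?f0.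
  - by apply: measurable_funeM.
  - case: fM => A [mA A0 fA]; exists A; split=> //; apply: subset_trans fA.
    apply: subsetC => t H ct; rewrite -EFinM lee_fin expr2.
    by rewrite ler_wpM2r ?f0// (le_trans (ler_norm _))// H.
have sf : sqint f.
  split=> //; apply/integrableP; split=> //.
  apply: (@le_lt_trans _ _ (M%:E)); last exact: ltry.
  apply: le_trans le2; apply: ge0_le_integral_nomeas => t _ /=.
    by rewrite lee_fin.
  by rewrite lee_fin ger0_norm// sqr_ge0.
split=> //; rewrite -lee_fin -l2sqE//.
Qed.

Lemma prod_halfhit_ge N k (s : seq Z) :
  expR (- \sum_(z <- s) (if hitcell N k z.2 then 1 else 0)) <=
  \prod_(z <- s) halfhit N k z.2.
Proof.
elim: s => [|z s IH]; first by rewrite !big_nil oppr0 expR0.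
rewrite !big_cons opprD expRD ler_pM ?expR_ge0//.
rewrite /halfhit; case: ifP => _; last by rewrite oppr0 expR0.
by rewrite expRN lef_pV2 ?posrE ?expR_gt0// (le_trans _ (expR_ge1Dx _))//.
Qed.

Lemma sigma0_le1 mu (s0 : R) : mu setT = 1%E ->
  (forall x, circle x -> (s0%:E <= sigma mu x)%E) -> s0 <= 1.
Proof.
move=> mu1 hs; rewrite -lee_fin.
apply: (le_trans (hs 0 _)); first by apply/circleE; rewrite lexx twopi_gt0.
rewrite -mu1 /sigma le_measure ?inE//.
apply: measurable_setb; apply: measurable_arc_mem;
  [exact: measurable_fst|exact: measurable_snd|exact: measurable_cst].
Qed.

(** The loss is majorized by the explicit [g] on every sample of size [n]: if all good cells are hit
    often, coercivity gives the first terms; if one of them is hit too rarely, its weighted product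
    alone exceeds the crude bound of [ftilde_l2sq_le]. *)
Lemma risk_le f mu (s0 M : R) n m N : 0 < s0 -> 0 <= M -> is_density f ->
  mu setT = 1%E -> Linf_bound f M ->
  (forall x, circle x -> (s0%:E <= sigma mu x)%E) ->
  (0 < n)%N -> (0 < N)%N -> 8 * (2 * m + 1)%:R <= s0 * N%:R ->
  (risk f mu n m <=
   ((1 + 2 * (s0 / 16) ^- 2) * inner (fun t => (fproj f m t - f t)%R) (fun t => (fproj f m t - f t)%R) +
    2 * (s0 / 16) ^- 2 * ((2 * m + 1)%:R / (pi * n%:R)) + 4 * M ^+ 2 / n%:R +
    (2 * n%:R ^+ 2 + 2 * M) * N%:R * (expR (s0 / 8 * n%:R) * (1 - s0 / 4) ^+ n))%:E)%E.
Proof.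
move=> s00 M0 df mu1 fM hs n0 N0 hN.
have [sf ffM] := density_sqint df M0 fM; have [mf [f0 f1]] := df.
have s01 := sigma0_le1 mu1 hs.
set c := s0 / 16; have c0 : 0 < c by rewrite divr_gt0.
set e := inner (fun t => (fproj f m t - f t)%R) _.
have e0 : 0 <= e by exact: inner_ge0.
have nr : 0 < n%:R :> R by rewrite ltr0n.
have ic0 : 0 <= c ^- 2 by rewrite invr_ge0 sqr_ge0.
pose W := (2 * n%:R ^+ 2 + 2 * M) * expR (s0 / 8 * n%:R).
have B0 : 0 <= 2 * n%:R ^+ 2 + 2 * M by rewrite addr_ge0 ?mulr_ge0 ?sqr_ge0.
have W0 : 0 <= W by rewrite mulr_ge0// expR_ge0.
pose K := (1 + 2 * c ^- 2) * e + 4 * M ^+ 2 / n%:R.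
have K0 : 0 <= K.
  rewrite addr_ge0//; first by rewrite mulr_ge0// addr_ge0// mulr_ge0.
  by rewrite divr_ge0 ?(ltW nr)// mulr_ge0// sqr_ge0.
(* The division by [n ^ 2] normalises the noise sums, which [iexp_quadratic_le] takes without the
   factor [n^-1]. *)
pose cc := 2 * c ^- 2 / n%:R ^+ 2.
have cc0 : 0 <= cc by rewrite divr_ge0 ?sqr_ge0// mulr_ge0.
(* Exceptional cells get weight 0: no number of hits is asked of them. *)
pose w (k : 'I_N) := if goodcell mu N s0 k then W else 0.
have w0 (k : 'I_N) : 0 <= w k by rewrite /w; case: ifP.
pose g (s : seq Z) := K + cc * \sum_(i < 2 * m + 1) (0 + \sum_(z <- s) noise f i z) ^+ 2
      + \sum_(k < N) w k * \prod_(z <- s) halfhit N k z.2.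
have prod0 k (s : seq Z) : 0 <= \prod_(z <- s) halfhit N k z.2.
  by apply: prodr_ge0 => z _; exact: halfhit_ge0.
have step1 : (risk f mu n m <= iexp f mu n (fun s => (g s)%:E))%E.
  apply: le_iexp => //.
    by move=> s; apply: integral_ge0 => t _; rewrite lee_fin sqr_ge0.
  move=> s sn.
  have S0 : 0 <= cc * \sum_(i < 2 * m + 1) (0 + \sum_(z <- s) noise f i z) ^+ 2.
    by rewrite mulr_ge0//; apply: sumr_ge0 => i _; exact: sqr_ge0.
  have P0 : 0 <= \sum_(k < N) w k * \prod_(z <- s) halfhit N k z.2.
    by apply: sumr_ge0 => k _; rewrite mulr_ge0.
  have [hit|] := pselect (forall k, (k < N)%N -> goodcell mu N s0 k ->
     s0 / 8 * (size s)%:R <= \sum_(z <- s) (if hitcell N k z.2 then 1 else 0)).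
    have cG : coercive m s c.
      apply: (@coercive_hitcell _ m s N (goodcell mu N s0) s0) => //.
        by rewrite sn.
      exact: badcell_count.
    apply: (le_trans (@ftilde_l2sq_coercive_le _ m s f M c sf ffM _ c0 cG)).
      by rewrite sn.
    rewrite lee_fin sn /g /K -/e; apply: (@le_trans _ _ ((1 + 2 * c ^- 2) * e + 4 * M ^+ 2 / n%:R +
      cc * \sum_(i < 2 * m + 1) (0 + \sum_(z <- s) noise f i z) ^+ 2)); last by rewrite lerDl.
    rewrite -!addrA lerD2l addrC lerD2l le_eqVlt; apply/orP; left; apply/eqP.
    rewrite /cc !mulr_sumr; apply: eq_bigr => i _; rewrite add0r.
    by field; rewrite !gt_eqF.
  move=> /existsNP[k /not_implyP[kN /not_implyP[gk]]].
  move=> /negP; rewrite -ltNge sn => hit.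
  apply: (le_trans (ftilde_l2sq_le _ _ sf ffM)).
  rewrite lee_fin sn /g.
  apply: (@le_trans _ _ (w (Ordinal kN) * \prod_(z <- s) halfhit N k z.2)); last first.
    rewrite (bigD1 (Ordinal kN))//= addrA.
    rewrite -[leLHS]addr0 lerD// ?lerDr ?(addr_ge0 K0 S0)//.
    by apply: sumr_ge0 => i _; rewrite mulr_ge0.
  rewrite /w /= gk /W -mulrA ler_peMr//.
  (* The total exponent is [s0 / 8 * n] minus the number of hits, which is positive on this
     sample. *)
  apply: (@le_trans _ _ (expR (s0 / 8 * n%:R) * expR (- \sum_(z <- s) (if hitcell N k z.2 then 1 else 0)))).
    by rewrite -expRD -[leLHS]expR0 ler_expR subr_ge0 ltW.
  by rewrite ler_wpM2l ?expR_ge0// prod_halfhit_ge.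
apply: (le_trans step1).
have rho0 : 0 <= 1 - s0 / 4 by lra.
have := @iexp_quadratic_le _ f mu (2 * m + 1) N cc (1 - s0 / 4) n df sf mu1 cc0 rho0
  K (fun=> 0) w K0 w0.
move=> H; apply: (le_trans (H _)).
  move=> k; rewrite /w; case: ifPn => gk; last by left.
  right; apply: integral_halfhit_le => //.
  apply: hitcell_measure_ge => //; apply: hs.
  apply/circleE; apply/andP; split.
    by rewrite -(gridpt0 N) le_gridpt.
  rewrite -(gridptN N0) /gridpt ltr_pM2r ?invr_gt0 ?ltr0n// ltr_pM2l ?twopi_gt0//.
  by rewrite ltr_nat.
rewrite lee_fin /K.
have -> : cc * \sum_(i < 2 * m + 1) (0 ^+ 2 + n%:R / pi) =
    2 * c ^- 2 * ((2 * m + 1)%:R / (pi * n%:R)).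
  rewrite expr0n add0r sumr_const card_ord -[_ *+ (2 * m + 1)]mulr_natl /cc.
  have := @pi_gt0 R; move: (pi : R) ((2 * m + 1)%:R : R) => p D p0.
  by field; rewrite !gt_eqF.
rewrite (addrAC _ (4 * M ^+ 2 / n%:R)) lerD2l.
apply: (@le_trans _ _ (\sum_(k < N) W * (1 - s0 / 4) ^+ n)).
  apply: ler_sum => k _; rewrite ler_wpM2r ?exprn_ge0// /w; case: ifP => //.
rewrite sumr_const card_ord -mulr_natl /W le_eqVlt; apply/orP; left; apply/eqP.
by ring.
Qed.

(** The left-hand side is at most the exponential of [- (s0 / 8 * n)], written as the fourth power
    of an inverse exponential and bounded with [1 + x <= expR x]. The power 4 compensates the number
    of cells, of order [n], times the crude loss, of order [n ^ 2], and still leaves [1 / n]. *)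
Lemma expR_decay (s0 : R) n : 0 < s0 -> s0 <= 1 -> (0 < n)%N ->
  expR (s0 / 8 * n%:R) * (1 - s0 / 4) ^+ n <= (32 / s0) ^+ 4 / n%:R ^+ 4.
Proof.
move=> s00 s01 n0; have nr : 0 < n%:R :> R by rewrite ltr0n.
have r0 : 0 <= 1 - s0 / 4 by lra.
have : (1 - s0 / 4) ^+ n <= expR (- (s0 / 4 * n%:R)).
  apply: (@le_trans _ _ (expR (- (s0 / 4)) ^+ n)).
    by rewrite lerXn2r ?nnegrE ?expR_ge0// expR_ge1Dx.
  by rewrite -expRM_natr mulNr.
move=> /(ler_wpM2l (expR_ge0 (s0 / 8 * n%:R))) /le_trans; apply.
rewrite -expRD (_ : _ + _ = - (s0 / 32 * n%:R * 4%:R)); last by field.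
have x0 : 0 < s0 / 32 * n%:R by rewrite mulr_gt0// divr_gt0.
have -> : (32 / s0) ^+ 4 / n%:R ^+ 4 = ((s0 / 32 * n%:R) ^+ 4)^-1.
  by field; rewrite !gt_eqF.
rewrite expRN lef_pV2 ?posrE ?exprn_gt0 ?expR_gt0//.
rewrite expRM_natr lerXn2r ?nnegrE ?expR_ge0 ?(ltW x0)//.
by apply: le_trans (expR_ge1Dx _); rewrite lerDr.
Qed.

Lemma risk_oracle_inequality (s0 : R) : 0 < s0 ->
  exists C1 C2 : R, 0 <= C1 /\ 0 <= C2 /\ forall M : R, 0 <= M -> exists2 C3 : R, 0 <= C3 &
   forall f mu, is_density f -> LU_law mu -> Linf_bound f M ->
     (forall x, circle x -> (s0%:E <= sigma mu x)%E) ->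
     forall n m : nat, Mset n m ->
       (risk f mu n m <=
          C1%:E * l2sq (fun t => (fproj f m t - f t)%R)
          + (C2 * (2 * m + 1)%:R / n%:R + C3 / n%:R)%:E)%E.
Proof.
move=> s00; have pi0 := @pi_gt0 R.
have ic0 : 0 <= (s0 / 16) ^- 2 by rewrite invr_ge0 sqr_ge0.
exists (1 + 2 * (s0 / 16) ^- 2), (2 * (s0 / 16) ^- 2 / pi); split; [|split].
- by rewrite addr_ge0// mulr_ge0.
- by rewrite divr_ge0 ?(ltW pi0)// mulr_ge0.
(* The grid will have [n * N0] cells; as [N0 >= 8 / s0] and the dimension is at most [n], it is fine
   enough for [coercive_hitcell]. *)
move=> M M0; pose N0 := (Num.truncn (8 / s0)).+1.
have B0 : 0 <= (32 / s0) ^+ 4 by rewrite exprn_ge0// divr_ge0// ltW.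
exists (4 * M ^+ 2 + (2 + 2 * M) * N0%:R * (32 / s0) ^+ 4).
  rewrite addr_ge0//; first by rewrite mulr_ge0// sqr_ge0.
  by rewrite mulr_ge0// mulr_ge0// addr_ge0// mulr_ge0.
move=> f mu df [mu1 _] fM hs n m /andP[m1 mn].
have dn : (2 * m + 1 <= n)%N by move: m1 mn; lia.
have n0 : (0 < n)%N by move: dn; lia.
have nr : 0 < n%:R :> R by rewrite ltr0n.
have n1 : 1 <= n%:R :> R by rewrite ler1n.
have [sf _] := density_sqint df M0 fM.
have N00 : (0 < n * N0)%N by rewrite muln_gt0 n0.
have hN : 8 * (2 * m + 1)%:R <= s0 * (n * N0)%:R.
  have : 8 / s0 <= N0%:R by rewrite ltW// truncnS_gt.
  rewrite ler_pdivrMr// natrM => h; apply: (@le_trans _ _ (8 * n%:R)).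
    by rewrite ler_pM2l// ler_nat.
  by rewrite mulrCA mulrC ler_pM2l// mulrC.
apply: (le_trans (risk_le s00 M0 df mu1 fM hs n0 N00 hN)).
rewrite l2sqE; last by apply: sqintB => //; exact: sqint_tpoly.
rewrite -EFinM -EFinD lee_fin.
have -> : 2 * (s0 / 16) ^- 2 * ((2 * m + 1)%:R / (pi * n%:R)) =
    2 * (s0 / 16) ^- 2 / pi * (2 * m + 1)%:R / n%:R :> R.
  move: (pi : R) pi0 ((2 * m + 1)%:R : R) => p p0 D.
  by field; rewrite !gt_eqF.
rewrite (mulrDl (4 * M ^+ 2)) !addrA lerD2l.
have := expR_decay s00 (sigma0_le1 mu1 hs) n0.
have c0 : 0 <= (2 * n%:R ^+ 2 + 2 * M) * (n * N0)%:R :> R.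
  by rewrite mulr_ge0// addr_ge0 ?mulr_ge0// sqr_ge0.
move=> /(ler_wpM2l c0) /le_trans; apply; rewrite natrM.
have NB0 : 0 <= N0%:R * (32 / s0) ^+ 4 / n%:R ^+ 3 :> R.
  by rewrite divr_ge0 ?exprn_ge0 ?(ltW nr)// mulr_ge0.
move: NB0; move: (N0%:R : R) ((32 / s0) ^+ 4) (n%:R : R) nr n1 => N' B n' nr n1 NB0.
have -> : (2 * n' ^+ 2 + 2 * M) * (n' * N') * (B / n' ^+ 4) =
    (2 * n' ^+ 2 + 2 * M) * (N' * B / n' ^+ 3) by field; rewrite gt_eqF.
have -> : (2 + 2 * M) * N' * B / n' = ((2 + 2 * M) * n' ^+ 2) * (N' * B / n' ^+ 3).
  by field; rewrite gt_eqF.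
rewrite ler_wpM2r// (mulrDl 2 (2 * M)) lerD2l ler_peMr ?mulr_ge0//.
by rewrite exprn_ege1.
Qed.

End RiskBound.

(** * Fejer means of continuous functions *)

Section Fejer.
Context {R : realType}.
Notation leb := (@lebesgue_measure R).
Implicit Types (x t : R) (g h : R -> R) (j k n m : nat).

(** Compactness of the segment in near-covering form, along the radii [n.+1%:R^-1]. Only [x] is
    confined to the segment; [t] ranges over the line. *)
Lemma continuous_unif_segment g (a b eps : R) : continuous g -> 0 < eps ->
  exists2 d : R, 0 < d & forall x t, a <= x <= b -> `|x - t| < d -> `|g x - g t| < eps.
Proof.
move=> cg e0.
have /compact_near_coveringP/(_ nat \oo
  (fun n x => forall t, `|x - t| < n.+1%:R^-1 -> `|g x - g t| < eps) _) := @segment_compact R a b.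
case.
  move=> x _.
  have e2 : 0 < eps / 2 by rewrite divr_gt0.
  have /cvgrPdist_lt/(_ _ e2)[d /= d0 xd] := cg x.
  have d2 : 0 < d / 2 by rewrite divr_gt0.
  exists (ball x (d / 2), [set n | n.+1%:R^-1 < d / 2]).
    split => /=; first exact: nbhsx_ballx.
    exact: near_infty_natSinv_lt (PosNum d2).
  move=> [y n] /= [xy nd] t yt.
  have h1 : `|g x - g y| < eps / 2.
    by apply: xd => /=; apply: lt_trans xy _; rewrite ltr_pdivrMr// ltr_pMr// ltr1n.
  have h2 : `|g x - g t| < eps / 2.
    apply: xd => /=; rewrite (splitr d) (le_lt_trans (ler_distD y _ _))// ltrD//.
    exact: lt_trans nd.
  by rewrite (splitr eps) (le_lt_trans (ler_distD (g x) _ _))// ltrD// distrC.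
move=> n _ /(_ n (leqnn n)) H; exists n.+1%:R^-1; first by rewrite invr_gt0.
by move=> x t xab; apply: H; rewrite /= in_itv.
Qed.

Definition is_tpoly m h : Prop := exists a : 'I_(2 * m + 1) -> R, h = tpoly a.

Lemma is_tpolyD m g h : is_tpoly m g -> is_tpoly m h -> is_tpoly m (fun x => g x + h x).
Proof.
move=> [a ->] [b ->]; exists (fun i => a i + b i); apply/funext => x.
by rewrite /tpoly -big_split; apply: eq_bigr => i _; rewrite mulrDl.
Qed.

Lemma is_tpolyZ m (c : R) h : is_tpoly m h -> is_tpoly m (fun x => c * h x).
Proof.
move=> [a ->]; exists (fun i => c * a i); apply/funext => x.
by rewrite /tpoly mulr_sumr; apply: eq_bigr => i _; rewrite mulrA.
Qed.

Lemma is_tpoly_sum m (I : Type) (r : seq I) (F : I -> R -> R) :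
  (forall i, is_tpoly m (F i)) -> is_tpoly m (fun x => \sum_(i <- r) F i x).
Proof.
move=> tF; elim: r => [|i r IH].
  exists (fun=> 0); apply/funext => x.
  by rewrite big_nil /tpoly big1// => i _; rewrite mul0r.
have := is_tpolyD (tF i) IH; congr is_tpoly; apply/funext => x.
by rewrite big_cons.
Qed.

Lemma is_tpoly_phi m j : (j < 2 * m + 1)%N -> is_tpoly m (@phi R j).
Proof.
move=> jm; exists (fun i => (i == Ordinal jm)%:R); apply/funext => x.
rewrite /tpoly (bigD1 (Ordinal jm))//= eqxx mul1r big1 ?addr0// => i /negbTE ->.
by rewrite mul0r.
Qed.

Lemma is_tpoly_cos m k : (k <= m)%N -> is_tpoly m (fun x => cos (k%:R * x)).
Proof.
have pi0 := @pi_gt0 R; case: k => [|k] km.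
  have := is_tpolyZ (Num.sqrt (2 * pi)) (@is_tpoly_phi m 0 _).
  rewrite addn1 => /(_ isT); congr is_tpoly; apply/funext => x.
  rewrite /phi eqxx mul0r cos0 div1r divff// gt_eqF// sqrtr_gt0 twopi_gt0//.
have jm : ((2 * k).+1 < 2 * m + 1)%N by move: km; lia.
have := is_tpolyZ (Num.sqrt pi) (is_tpoly_phi jm); congr is_tpoly; apply/funext => x.
rewrite /phi /= mul2n odd_double /= doubleK mulrC mulfVK//.
by rewrite gt_eqF// sqrtr_gt0.
Qed.

Lemma is_tpoly_sin m k : (k <= m)%N -> is_tpoly m (fun x => sin (k%:R * x)).
Proof.
have pi0 := @pi_gt0 R; case: k => [|k] km.
  exists (fun=> 0); apply/funext => x.
  by rewrite mul0r sin0 /tpoly big1// => i _; rewrite mul0r.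
have jm : ((2 * k.+1) < 2 * m + 1)%N by move: km; lia.
have := is_tpolyZ (Num.sqrt pi) (is_tpoly_phi jm); congr is_tpoly; apply/funext => x.
rewrite /phi mul2n odd_double /= doubleK mulrC mulfVK//.
by rewrite gt_eqF// sqrtr_gt0.
Qed.

Lemma is_tpoly_cosB m j k : (j <= m)%N -> (k <= m)%N ->
  is_tpoly m (fun x => cos ((j%:R - k%:R) * x)).
Proof.
move=> jm km; have [kj|/ltnW jk] := leqP k j.
  by rewrite -natrB//; apply: is_tpoly_cos; move: jm km; lia.
have := @is_tpoly_cos m (k - j); rewrite natrB//.
have -> : (fun x => cos ((j%:R - k%:R) * x)) = (fun x => cos ((k%:R - j%:R) * x)).
  by apply/funext => x; rewrite -[in RHS]cosN -mulNr opprB.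
by apply; move: jm km; lia.
Qed.

Lemma is_tpoly_sinB m j k : (j <= m)%N -> (k <= m)%N ->
  is_tpoly m (fun x => sin ((j%:R - k%:R) * x)).
Proof.
move=> jm km; have [kj|/ltnW jk] := leqP k j.
  by rewrite -natrB//; apply: is_tpoly_sin; move: jm km; lia.
have -> : (fun x => sin ((j%:R - k%:R) * x)) = (fun x => (-1) * sin ((k%:R - j%:R) * x)).
  by apply/funext => x; rewrite mulN1r -sinN -mulNr opprB.
by apply: is_tpolyZ; rewrite -natrB//; apply: is_tpoly_sin; move: jm km; lia.
Qed.

(** The Fejer kernel: [n^-1] times the squared modulus of the sum over [j < n] of the complex
    exponentials of frequency [j] at [x - t]. The double sum gives both its sign and its expansion
    as a trigonometric polynomial in [x]. *)
Definition fejer n x t : R :=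
  n%:R^-1 * \sum_(j < n) \sum_(k < n) cos ((j%:R - k%:R) * (x - t)).

Lemma fejer_ge0 n x t : 0 <= fejer n x t.
Proof.
rewrite mulr_ge0 ?invr_ge0//.
have -> : \sum_(j < n) \sum_(k < n) cos ((j%:R - k%:R) * (x - t)) =
    (\sum_(j < n) cos (j%:R * (x - t))) ^+ 2 + (\sum_(j < n) sin (j%:R * (x - t))) ^+ 2.
  rewrite !expr2 !big_distrlr /= -big_split; apply: eq_bigr => j _.
  by rewrite -big_split; apply: eq_bigr => k _; rewrite mulrBl cosB.
by rewrite addr_ge0 ?sqr_ge0.
Qed.

Lemma sqint_cos_shift (w x : R) : sqint (fun t => cos (w * (x - t))).
Proof.
have -> : (fun t => cos (w * (x - t))) =
    (fun t => cos (w * x) * cos (w * t) + sin (w * x) * sin (w * t)).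
  by apply/funext => t; rewrite mulrBr cosB.
by apply: sqintD; apply: sqintZ; [exact: sqint_cosM|exact: sqint_sinM].
Qed.

Lemma inner1_cos_shift j k x :
  inner (fun t => cos ((j%:R - k%:R) * (x - t))) (fun=> 1) = (j == k)%:R * (2 * pi).
Proof.
set w := j%:R - k%:R.
transitivity (inner (fun t => cos (w * x) * cos (w * t) + sin (w * x) * sin (w * t))
   (fun=> 1 : R)).
  by apply: eq_inner => t _; rewrite mulrBr cosB.
rewrite innerDl; [|by apply: sqintZ; exact: sqint_cosM|by apply: sqintZ; exact: sqint_sinM|exact: sqint_cst].
rewrite !innerZl; try exact: sqint_cst; try exact: sqint_cosM; try exact: sqint_sinM.
rewrite inner1_cosM ?sin_natB_twopi// inner1_sinM ?cos_natB_twopi// mulr0 addr0.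
rewrite {2}/w subr_eq0 eqr_nat; case: (eqVneq j k) => [jk|_]; last by rewrite !mul0r mulr0.
by rewrite /w jk subrr mul0r cos0 mul1r.
Qed.

Lemma sqint_fejer n x : sqint (fejer n x).
Proof.
by apply: sqintZ; apply: sqint_sum => j; apply: sqint_sum => k; exact: sqint_cos_shift.
Qed.

Lemma inner1_fejer n x : (0 < n)%N -> inner (fejer n x) (fun=> 1) = 2 * pi.
Proof.
move=> n0; rewrite innerZl; [|by apply: sqint_sum => j; apply: sqint_sum => k;
  exact: sqint_cos_shift|exact: sqint_cst].
rewrite inner_suml; [|by move=> j; apply: sqint_sum => k; exact: sqint_cos_shift|exact: sqint_cst].
under eq_bigr => j _.
  rewrite inner_suml; [|by move=> k; exact: sqint_cos_shift|exact: sqint_cst].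
  under eq_bigr do rewrite inner1_cos_shift.
  rewrite (bigD1 j)//= eqxx mul1r big1 ?addr0; last first.
    by move=> k kj; rewrite (negbTE (_ : j != k :> nat)) ?mul0r// eq_sym.
  over.
by rewrite sumr_const card_ord -[(2 * pi) *+ n]mulr_natl mulKf// pnatr_eq0 -lt0n.
Qed.

Lemma sum_ord_eq n (a : nat) : \sum_(k < n) (a == k)%:R = (a < n)%N%:R :> R.
Proof.
have [an|na] := ltnP a n.
  rewrite (bigD1 (Ordinal an))//= eqxx big1 ?addr0// => k ka.
  by rewrite (negbTE (_ : a != k :> nat))// eq_sym.
by rewrite big1// => k _; rewrite gtn_eqF// (leq_trans (ltn_ord k)).
Qed.

Lemma sum_ord_succ n : (0 < n)%N -> \sum_(j < n) (j.+1 < n)%N%:R = n%:R - 1 :> R.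
Proof.
case: n => // n _; rewrite big_ord_recr /= ltnn addr0 -natr1 addrK.
rewrite (eq_bigr (fun=> 1)); first by rewrite sumr_const card_ord.
by move=> j _; rewrite ltnS ltn_ord.
Qed.

(** Only the [2 * (n - 1)] ordered pairs of adjacent indices contribute. Consequently the kernel
    integrates [1 - cos (x - t)] to [2 * pi / n], which controls its mass away from [x] as in
    Korovkin's theorem. *)
Lemma inner_cos_fejer n x : (0 < n)%N ->
  inner (fun t => cos (x - t)) (fejer n x) = 2 * pi * (1 - n%:R^-1).
Proof.
move=> n0; have nn0 : n%:R != 0 :> R by rewrite pnatr_eq0 -lt0n.
pose F (j k : nat) t := cos ((j.+1%:R - k%:R) * (x - t)) + cos ((j%:R - k.+1%:R) * (x - t)).
have sF j k : sqint (F j k) by apply: sqintD; exact: sqint_cos_shift.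
transitivity (inner (fun t => (n%:R^-1 / 2) * \sum_(j < n) \sum_(k < n) F j k t) (fun=> 1 : R)).
  apply: eq_inner => t _; rewrite mulr1 /fejer mulrCA -mulrA; congr (_ * _).
  rewrite !mulr_sumr; apply: eq_bigr => j _; rewrite !mulr_sumr; apply: eq_bigr => k _.
  rewrite /F -[j.+1%:R]natr1 -[k.+1%:R]natr1; set u := x - t; set w := j%:R - k%:R.
  have -> : (j%:R + 1 - k%:R) * u = w * u + u by rewrite /w; ring.
  have -> : (j%:R - (k%:R + 1)) * u = w * u - u by rewrite /w; ring.
  by rewrite (cosD (w * u)) (cosB (w * u)); clearbody u w; field.
rewrite innerZl; [|by apply: sqint_sum => j; apply: sqint_sum => k|exact: sqint_cst].
rewrite inner_suml; [|by move=> j; apply: sqint_sum => k|exact: sqint_cst].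
have innerF (j : 'I_n) : inner (fun t => \sum_(k < n) F j k t) (fun=> 1) =
    \sum_(k < n) ((j.+1 == k)%:R * (2 * pi) + (k.+1 == j)%:R * (2 * pi)).
  rewrite inner_suml; [|by []|exact: sqint_cst].
  apply: eq_bigr => k _; rewrite innerDl; try exact: sqint_cst; try exact: sqint_cos_shift.
  by rewrite !inner1_cos_shift (eq_sym _ k.+1).
under eq_bigr do rewrite innerF big_split /=.
rewrite big_split /= [X in _ + X]exchange_big /= -mulr2n.
have -> : \sum_(j < n) \sum_(k < n) (j.+1 == k)%:R * (2 * pi) = (n%:R - 1) * (2 * pi) :> R.
  rewrite -sum_ord_succ// mulr_suml; apply: eq_bigr => j _.
  by rewrite -mulr_suml sum_ord_eq.
by move: (pi : R) => p; field.
Qed.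

Definition fejer_mean n g x : R := (2 * pi)^-1 * inner g (fejer n x).

Lemma is_tpoly_fejer_mean n g : sqint g -> is_tpoly n (fejer_mean n g).
Proof.
move=> sg.
have -> : fejer_mean n g = (fun x => (2 * pi)^-1 * (n%:R^-1 *
    \sum_(j < n) \sum_(k < n)
     (inner g (fun t => cos ((j%:R - k%:R) * t)) * cos ((j%:R - k%:R) * x) +
      inner g (fun t => sin ((j%:R - k%:R) * t)) * sin ((j%:R - k%:R) * x)))).
  apply/funext => x; congr (_ * _); rewrite innerC innerZl//; last first.
    by apply: sqint_sum => j; apply: sqint_sum => k; exact: sqint_cos_shift.
  congr (_ * _); rewrite inner_suml//; last first.
    by move=> j; apply: sqint_sum => k; exact: sqint_cos_shift.
  apply: eq_bigr => j _; rewrite inner_suml//; last by move=> k; exact: sqint_cos_shift.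
  apply: eq_bigr => k _; set w := j%:R - k%:R.
  rewrite mulrC (mulrC (inner g (fun t => sin _))) !(innerC g) -!innerZl//;
    try exact: sqint_cosM; try exact: sqint_sinM.
  rewrite -innerDl//; [|by apply: sqintZ; exact: sqint_cosM|by apply: sqintZ; exact: sqint_sinM].
  by apply: eq_inner => t _; rewrite mulrBr cosB.
apply: is_tpolyZ; apply: is_tpolyZ; apply: is_tpoly_sum => j; apply: is_tpoly_sum => k.
apply: is_tpolyD; apply: is_tpolyZ; [apply: is_tpoly_cosB|apply: is_tpoly_sinB];
  exact/ltnW/ltn_ord.
Qed.

Lemma cos_le_away (d u : R) : 0 <= d <= pi -> d <= `|u| <= 2 * pi - d -> cos u <= cos d.
Proof.
move=> /andP[d0 dpi] /andP[du ud]; rewrite -cos_norm.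
have [up|pu] := leP `|u| pi.
  by rewrite leNgt ltr_cos ?in_itv/= ?d0 ?(le_trans d0) ?up// -leNgt.
have -> : cos `|u| = cos (2 * pi - `|u|).
  have := @cos_nat_twopi R 1; have := @sin_nat_twopi R 1; rewrite mul1r cosB => -> ->.
  by rewrite mul1r mul0r addr0.
rewrite leNgt ltr_cos ?in_itv/= -?leNgt; first lra.
- by apply/andP; split; lra.
- by apply/andP; split; lra.
Qed.

(* [g] need not be periodic: the two cells adjacent to [0] on the circle absorb
   its jump there. *)
Lemma fejer_mean_sqr_dist_le g (M eps : R) n N : (0 < n)%N -> (1 < N)%N ->
  sqint g -> (forall t, 0 <= g t <= M) -> 0 <= eps ->
  (forall x t, 0 <= x <= 2 * pi -> `|x - t| < 2 * pi / N%:R -> `|g x - g t| < eps) ->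
  forall x, circle x ->
  (fejer_mean n g x - g x) ^+ 2 <=
  (eps + M / (1 - cos (2 * pi / N%:R)) / n%:R) ^+ 2
    + M ^+ 2 * (cellI N 0 x + cellI N N.-1 x).
Proof.
move=> n0 N1 sg gM e0 ug x cx; have tp := @twopi_gt0 R.
have N0 : (0 < N)%N by rewrite (ltn_trans _ N1).
set d := 2 * pi / N%:R; set C := M / (1 - cos d).
have sK := sqint_fejer n x; have s1 := @sqint_cst R.
have nr : 0 < n%:R :> R by rewrite ltr0n.
have Nr : 0 < N%:R :> R by rewrite ltr0n.
have d0 : 0 < d by rewrite divr_gt0.
have dpi : d <= pi.
  rewrite /d ler_pdivrMr// mulrC ler_pM2l ?pi_gt0//.
  by rewrite ler_nat.
have M0 : 0 <= M by have /andP[a b] := gM 0; exact: le_trans b.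
have cd : 0 < 1 - cos d.
  rewrite subr_gt0 -[ltRHS](@cos0 R) ltr_cos// in_itv /= ?lexx ?pi_ge0//.
  by rewrite (ltW d0).
have C0 : 0 <= C by rewrite divr_ge0// ltW.
have mean (c : R) : inner (fun=> c) (fejer n x) = c * (2 * pi).
  transitivity (inner (fun t => c * (fun=> 1) t) (fejer n x)).
    by apply: eq_inner => t _; rewrite mulr1.
  by rewrite innerZl// innerC inner1_fejer.
have cI0 k y : 0 <= cellI N k y :> R by rewrite /cellI; case: ifP.
have T0 : 0 <= fejer_mean n g x <= M.
  rewrite /fejer_mean mulrC ler_pdivrMr// divr_ge0 ?(ltW tp)//=.
    rewrite -mean; apply: le_inner => // t _.
    by rewrite ler_wpM2r ?fejer_ge0//; have /andP[] := gM t.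
  rewrite -(mul0r (2 * pi)) -mean; apply: le_inner => // t _.
  by rewrite ler_wpM2r ?fejer_ge0//; have /andP[] := gM t.
have /andP[gx0 gxM] := gM x; have /andP[T00 TM] := T0.
have [ends|] := boolP (incell N 0 x || incell N N.-1 x).
  apply: (@le_trans _ _ (M ^+ 2)).
    rewrite -real_normK ?num_real// lerXn2r ?nnegrE// ler_norml; apply/andP; split; lra.
  rewrite -[leLHS]add0r lerD ?sqr_ge0// ler_peMr ?sqr_ge0//.
  by move: ends => /orP[]; rewrite {1 2}/cellI => ->; rewrite ?lerDl ?lerDr// -/(cellI _ _ _).
rewrite negb_or => /andP[x0 xN].
have /circleE/andP[xge0 xlt] := cx.
have dx : d <= x.
  move: x0; rewrite /incell gridpt0 xge0 /= -leNgt gridptS// gridpt0 add0r.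
  exact.
have xd : x <= 2 * pi - d.
  move: xN; rewrite /incell prednK// gridptN// xlt andbT -ltNge.
  have := @gridptS R N N.-1 N0; rewrite prednK// gridptN// -/d => ->.
  by rewrite addrK => /ltW.
(* Near [x] uniform continuity applies; elsewhere [1 - cos (x - t)] is at least [1 - cos d], and [C]
   is chosen to recover [M]. Since [x] avoids the end cells, the distance from [x] to [t] is also at
   most [2 * pi - d]. *)
have near t : circle t -> `|g t - g x| <= eps + C * (1 - cos (x - t)).
  move=> /circleE/andP[t0 t2]; have [xt|xt] := ltP `|x - t| d.
    rewrite -[leLHS]addr0 lerD//; last by rewrite mulr_ge0// subr_ge0 cos_le1.
    by rewrite distrC ltW// ug// xge0 ltW.
  apply: (@le_trans _ _ M).
    have /andP[a b] := gM t; rewrite ler_norml; apply/andP; split; lra.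
  rewrite -[leLHS]add0r lerD// /C mulrAC ler_pdivlMr// ler_wpM2l// lerD2l lerN2.
  apply: cos_le_away; first by rewrite (ltW d0).
  by rewrite xt/= ler_norml; apply/andP; split; lra.
have sB : sqint (fun t => eps + C * (1 - cos (x - t))).
  apply: sqintD => //; apply: sqintZ; apply: sqintB => //.
  by have := sqint_cos_shift 1 x; under eq_fun do rewrite mul1r.
have B : inner (fun t => eps + C * (1 - cos (x - t))) (fejer n x) =
    2 * pi * (eps + C / n%:R).
  have sc : sqint (fun t => cos (x - t)).
    by have := sqint_cos_shift 1 x; under eq_fun do rewrite mul1r.
  rewrite innerDl// ?innerZl//; try exact: sqintB; last by apply: sqintZ; exact: sqintB.
  rewrite innerBl// !mean inner_cos_fejer// mul1r.
  by move: (pi : R) => p; field; rewrite gt_eqF.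
have TgE : fejer_mean n g x - g x = (2 * pi)^-1 * inner (fun t => g t - g x) (fejer n x).
  by rewrite innerBl// mean mulrBr [X in _ = _ - X]mulrC mulfK// gt_eqF.
have : `|fejer_mean n g x - g x| <= eps + C / n%:R.
  rewrite TgE normrM ger0_norm ?invr_ge0 ?(ltW tp)// mulrC ler_pdivrMr// (mulrC _ (2 * pi)) -B.
  rewrite ler_norml; apply/andP; split.
    rewrite -mulN1r -innerZl//; apply: le_inner => //; [exact: sqintZ|exact: sqintB|].
    move=> t ct; rewrite ler_wpM2r ?fejer_ge0// mulN1r.
    by have := near t ct; rewrite ler_norml => /andP[].
  apply: le_inner => //; first exact: sqintB.
  move=> t ct; rewrite ler_wpM2r ?fejer_ge0//.
  by have := near t ct; rewrite ler_norml => /andP[].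
move=> H; rewrite -[leLHS]addr0 lerD//; last by rewrite mulr_ge0 ?sqr_ge0// addr_ge0.
rewrite -real_normK ?num_real// lerXn2r ?nnegrE//.
by rewrite addr_ge0// divr_ge0// ltW.
Qed.

End Fejer.

(** * Density of trigonometric polynomials and the bias over Sobolev ellipsoids *)

Section Parseval.
Context {R : realType}.
Notation leb := (@lebesgue_measure R).
Implicit Types (f g : R -> R) (m n : nat).

Definition clamp (M y : R) : R := if y < 0 then 0 else if M < y then M else y.

Lemma clamp_itv (M y : R) : 0 <= M -> 0 <= clamp M y <= M.
Proof.
move=> M0; rewrite /clamp; case: (ltP y 0) => y0; first by rewrite lexx.
by case: (ltP M y) => yM; rewrite ?lexx ?M0// y0.
Qed.

Lemma clamp_lipschitz (M a b : R) : 0 <= M -> `|clamp M a - clamp M b| <= `|a - b|.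
Proof.
move=> M0; wlog ab : a b / a <= b.
  by move=> H; have [ab|/ltW ba] := leP a b; [exact: H|rewrite distrC (distrC a) H].
have h : a - b <= 0 by lra.
rewrite (ler0_norm h) ler_norml /clamp.
by case: (ltP a 0) => ?; case: (ltP b 0) => ?; case: (ltP M a) => ?; case: (ltP M b) => ?;
  apply/andP; split; lra.
Qed.

Lemma clamp_dist (M a y : R) : 0 <= a <= M -> `|a - clamp M y| <= `|a - y|.
Proof.
move=> /andP[a0 aM]; have := clamp_lipschitz a y (le_trans a0 aM).
by rewrite {1}/clamp ltNge a0 /= ltNge aM.
Qed.

Lemma continuous_clamp (M : R) g : 0 <= M -> continuous g ->
  continuous (fun t => clamp M (g t)).
Proof.
move=> M0 cg x; apply/cvgrPdist_lt => e e0.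
have /cvgrPdist_lt/(_ _ e0) := cg x; apply: filterS => t.
exact: le_lt_trans (clamp_lipschitz _ _ M0).
Qed.

(** Continuous functions approximate [f] in mean. Clamping between 0 and [M] does not increase the
    distance to [f] almost everywhere, and as the difference is then at most [M], approximation in
    mean becomes approximation in mean square. *)
Lemma continuous_approx f (M eta : R) : is_density f -> 0 <= M -> Linf_bound f M ->
  0 < eta -> exists g, [/\ continuous g, forall t, 0 <= g t <= M &
    inner (fun t => f t - g t) (fun t => f t - g t) <= eta].
Proof.
move=> df M0 fM eta0; have [mf [f0 f1]] := df; have [sf _] := density_sqint df M0 fM.
have intf : leb.-integrable (@circle R) (EFin \o f).
  have := integrable_sqintM sf (sqint_cst 1).
  by under [X in EFin \o X]eq_fun do rewrite mulr1.
have [g_ [cg ig]] := approximation_continuous_integrable measurable_circle lebesgue_circle_lty intf.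
(* [M + 1] rather than [M], since [M] may be 0. *)
have e1 : 0 < eta / (M + 1) by rewrite divr_gt0//; lra.
move=> /fine_fcvg/cvgrPdist_lt/(_ _ e1)[n _ /(_ n (leqnn n))] /=.
rewrite sub0r normrN.
pose I := (\int[leb]_(t in @circle R) `|(f t - g_ n t)%:E|)%E.
have intI : leb.-integrable (@circle R) (fun t => (f t - g_ n t)%:E).
  exact: (integrableB measurable_circle intf (ig n)).
have finI : I \is a fin_num.
  apply: integrable_fin_num; first exact: measurable_circle.
  by apply: integrable_abse => //; exact: measurable_circle.
rewrite -/I => Ilt.
have {}Ilt : (I <= (eta / (M + 1))%:E)%E.
  by rewrite -(fineK finI) lee_fin (le_trans (ler_norm _))// ltW.
exists (fun t => clamp M (g_ n t)); split.
- by apply: continuous_clamp => //; exact: cg.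
- by move=> t; exact: clamp_itv.
have sg : sqint (fun t => clamp M (g_ n t)).
  apply: (@sqint_continuous_le _ _ M); first by apply: continuous_clamp => //; exact: cg.
  by move=> t; have /andP[a b] := clamp_itv (g_ n t) M0; rewrite ger0_norm.
have sfg : sqint (fun t => f t - clamp M (g_ n t)) by exact: sqintB.
rewrite -lee_fin -l2sqE// /l2sq.
apply: (@le_trans _ _ (M%:E * I)%E); last first.
  apply: (@le_trans _ _ (M%:E * (eta / (M + 1))%:E)%E).
    by apply: lee_wpmul2l => //; rewrite lee_fin.
  rewrite -EFinM lee_fin mulrA ler_pdivrMr; last by lra.
  by rewrite mulrC ler_pM2l//; lra.
have mI := measurable_int _ intI.
rewrite /I -ge0_integralZl_EFin//; last 2 first.
- exact: measurable_circle.
- exact: measurableT_comp.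
apply: ae_ge0_le_integral => //.
- exact: measurable_circle.
- by move=> t _; rewrite lee_fin sqr_ge0.
- by apply/measurable_EFinP; apply: measurable_funX; have [] := sfg.
- by move=> t _; rewrite mule_ge0.
- by apply: measurable_funeM; exact: measurableT_comp.
case: fM => A [mA A0 fA]; exists A; split=> //; apply: subset_trans fA.
apply: subsetC => t H ct; rewrite -EFinM lee_fin.
have ft : 0 <= f t <= M by rewrite f0//= (le_trans (ler_norm _))// H.
rewrite -real_normK ?num_real// expr2 ler_pM//; last exact: clamp_dist.
have /andP[a b] := clamp_itv (g_ n t) M0; have /andP[c d] := ft.
by rewrite ler_norml; apply/andP; split; lra.
Qed.

Lemma fproj_best m (a : 'I_(2 * m + 1) -> R) f : sqint f ->
  inner (fun t => fproj f m t - f t) (fun t => fproj f m t - f t) <=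
  inner (fun t => tpoly a t - f t) (fun t => tpoly a t - f t).
Proof.
move=> sf; rewrite inner_sqB_fproj// inner_sqB_tpoly// lerDl.
by apply: sumr_ge0 => i _; exact: sqr_ge0.
Qed.

(** The projection is at least as close to [f] as the Fejer mean of a continuous approximation [g].
    The budget is [eps / 2] for [f - g], [eps / 4] for the uniform part of the Fejer error and
    [eps / 8] for the two end cells. *)
Lemma fproj_dist_small f (M eps : R) : is_density f -> 0 <= M -> Linf_bound f M ->
  0 < eps -> exists m,
  inner (fun t => fproj f m t - f t) (fun t => fproj f m t - f t) <= eps.
Proof.
move=> df M0 fM eps0; have [sf _] := density_sqint df M0 fM.
have pi0 := @pi_gt0 R; have tp := @twopi_gt0 R.
have e4 : 0 < eps / 4 by rewrite divr_gt0.
have [g [cg gM fg]] := continuous_approx df M0 fM e4.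
(* The bound by 1 allows the square of [e1] to be replaced by [e1] at the end. *)
pose e1 := Num.min 1 (eps / (64 * pi)).
have e10 : 0 < e1 by rewrite lt_min ltr01 divr_gt0// mulr_gt0.
have e11 : e1 <= 1 by rewrite ge_min lexx.
have e1e : e1 * (64 * pi) <= eps.
  by rewrite -ler_pdivlMr ?mulr_gt0// ge_min lexx orbT.
have [d d0 ug] := continuous_unif_segment 0 (2 * pi) cg e10.
(* The first summand makes a cell at most [d] long, the second makes the two end cells cheap, and
   [.+2] ensures [1 < N]. *)
pose N := (Num.truncn (2 * pi / d + 64 * pi * M ^+ 2 / eps)).+2.
have pd0 : 0 <= 2 * pi / d by rewrite divr_ge0// ltW.
have pM0 : 0 <= 64 * pi * M ^+ 2 / eps.
  by rewrite divr_ge0 ?(ltW eps0)// mulr_ge0 ?sqr_ge0// mulr_ge0// ltW.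
have NB : 2 * pi / d + 64 * pi * M ^+ 2 / eps <= N%:R.
  apply: (@le_trans _ _ (Num.truncn (2 * pi / d + 64 * pi * M ^+ 2 / eps)).+1%:R).
    by rewrite ltW// truncnS_gt.
  by rewrite ler_nat.
have N0 : (0 < N)%N by [].
have Nr : 0 < N%:R :> R by rewrite ltr0n.
have Nd : 2 * pi / N%:R <= d.
  rewrite ler_pdivrMr// [leRHS]mulrC -ler_pdivrMr//.
  by apply: le_trans NB; rewrite lerDl.
have NM : M ^+ 2 * (2 * pi / N%:R + 2 * pi / N%:R) <= eps / 16.
  have : 64 * pi * M ^+ 2 / eps <= N%:R by apply: le_trans NB; rewrite lerDr.
  rewrite ler_pdivrMr// => h.
  have -> : M ^+ 2 * (2 * pi / N%:R + 2 * pi / N%:R) = 4 * pi * M ^+ 2 / N%:R.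
    by move: (pi : R) (M ^+ 2) => p q; field; rewrite gt_eqF.
  rewrite ler_pdivrMr//; lra.
pose C := M / (1 - cos (2 * pi / N%:R)).
pose n := (Num.truncn (C / e1)).+1.
have n0 : (0 < n)%N by [].
have nr : 0 < n%:R :> R by rewrite ltr0n.
have Cn : C / n%:R <= e1.
  by rewrite ler_pdivrMr// mulrC -ler_pdivrMr// ltW// truncnS_gt.
have C0 : 0 <= C by rewrite divr_ge0// subr_ge0 cos_le1.
have sg : sqint g.
  by apply: (@sqint_continuous_le _ _ M) => // t; have /andP[a b] := gM t; rewrite ger0_norm.
have [a Ta] := is_tpoly_fejer_mean n sg.
have sT : sqint (fejer_mean n g) by rewrite Ta; exact: sqint_tpoly.
exists n; apply: (le_trans (fproj_best a sf)); rewrite -Ta.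
have -> : inner (fun t => fejer_mean n g t - f t) (fun t => fejer_mean n g t - f t) =
    inner (fun t => (fejer_mean n g t - g t) - (f t - g t))
          (fun t => (fejer_mean n g t - g t) - (f t - g t)).
  by apply: eq_inner => t _; ring.
apply: (le_trans (inner_sqB_le _ _)); [exact: sqintB|exact: sqintB|].
have s1 := @sqint_cst R.
have : inner (fun t => fejer_mean n g t - g t) (fun t => fejer_mean n g t - g t) <=
    (e1 + C / n%:R) ^+ 2 * (2 * pi) + M ^+ 2 * (2 * pi / N%:R + 2 * pi / N%:R).
  have sc k : sqint (fun t : R => cellI N k t * 1) by exact: sqint_cellI.
  have E (Q : R) : inner (fun t => Q * 1 + M ^+ 2 * (cellI N 0 t * 1 + cellI N N.-1 t * 1))
      (fun=> 1 : R) = Q * (2 * pi) + M ^+ 2 * (2 * pi / N%:R + 2 * pi / N%:R).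
    rewrite innerDl//; last by apply: sqintZ; exact: sqintD.
    rewrite innerZl// innerZl//; last exact: sqintD.
    rewrite innerDl// !inner_cellI1//; congr (_ * _ + _).
    by rewrite /inner Rintegral_circle_cst !mul1r.
  rewrite -E.
  apply: le_inner => //; try exact: sqintB.
    by apply: sqintD; [exact: sqintZ|apply: sqintZ; exact: sqintD].
  move=> t ct; rewrite -expr2 !mulr1.
  apply: fejer_mean_sqr_dist_le => //; first exact: ltW.
  by move=> x y xx xy; apply: ug => //; exact: lt_le_trans Nd.
have : (e1 + C / n%:R) ^+ 2 <= 4 * e1.
  have : 0 <= C / n%:R by rewrite divr_ge0// ltW.
  move: (C / n%:R) Cn => y ye y0; nra.
move=> /(ler_wpM2r (ltW tp)); lra.
Qed.

Lemma fproj_dist_split f m m' : sqint f -> (m <= m')%N ->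
  inner (fun t => fproj f m t - f t) (fun t => fproj f m t - f t) =
  inner (fun t => fproj f m' t - f t) (fun t => fproj f m' t - f t) +
  \sum_(2 * m + 1 <= i < 2 * m' + 1) inner f (@phi R i) ^+ 2.
Proof.
move=> sf mm; rewrite !inner_sqB_fproj//.
rewrite -!(big_mkord predT (fun i => inner f (@phi R i) ^+ 2)).
rewrite [X in _ = _ - X + _](big_cat_nat (n := 2 * m + 1))//=; last first.
  by move: mm; lia.
by rewrite opprD addrA subrK.
Qed.

(** Parseval is used through a far projection [m'] whose squared bias is at most [eps]: the squared
    bias at [m] exceeds it by a finite sum over indices [i >= D], where [alpha beta i] is at least
    the power [beta] of [D], and this sum is controlled by the Sobolev series. *)
Lemma sobolev_fproj_dist f (M beta Rad : R) m : is_density f -> 0 <= M ->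
  Linf_bound f M -> 0 < beta -> sobolev beta Rad f ->
  inner (fun t => fproj f m t - f t) (fun t => fproj f m t - f t) <=
  Rad ^+ 2 / pi `^ (2 * beta) / ((2 * m + 1)%:R `^ beta) ^+ 2.
Proof.
move=> df M0 fM b0 sob; have [sf _] := density_sqint df M0 fM.
set S := Rad ^+ 2 / _; set D := (2 * m + 1)%N.
have D0 : 0 < D%:R `^ beta :> R by rewrite powR_gt0// ltr0n /D addn1.
apply/ler_addgt0Pr => eps eps0.
have [m2 hm2] := fproj_dist_small df M0 fM eps0.
pose m' := maxn m m2.
have hm' : inner (fun t => fproj f m' t - f t) (fun t => fproj f m' t - f t) <= eps.
  apply: le_trans hm2; rewrite (fproj_dist_split sf (leq_maxr m m2)) lerDl.
  by apply: sumr_ge0 => i _; exact: sqr_ge0.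
rewrite (fproj_dist_split sf (leq_maxl m m2)) -/m' addrC lerD//.
rewrite ler_pdivlMr ?exprn_gt0// mulr_suml.
apply: (@le_trans _ _ (\sum_(D <= i < 2 * m' + 1)
    (alpha beta i) ^+ 2 * inner f (@phi R i) ^+ 2)).
  rewrite !big_nat; apply: ler_sum => i /andP[Di _].
  rewrite mulrC ler_wpM2r ?sqr_ge0// lerXn2r ?nnegrE ?powR_ge0//.
    by rewrite /alpha; case: ifP; rewrite powR_ge0.
  rewrite /alpha; case: ifP => _; apply: ge0_ler_powR; rewrite ?nnegrE ?(ltW b0)// ler_nat//.
  exact: leqW.
rewrite -lee_fin; apply: le_trans (ltW sob).
apply: (@le_trans _ _ (\sum_(0 <= i < 2 * m' + 1)
    ((alpha beta i) ^+ 2 * inner f (@phi R i) ^+ 2)%:E)%E).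
  rewrite sumEFin lee_fin [leRHS](big_cat_nat (n := D))//=; last first.
    by rewrite /D; have := leq_maxl m m2; rewrite -/m'; lia.
  by rewrite lerDr; apply: sumr_ge0 => i _; rewrite mulr_ge0 ?sqr_ge0.
by apply: nneseries_lim_ge => i _ _; rewrite lee_fin mulr_ge0 ?sqr_ge0.
Qed.

End Parseval.

(** * Exponents and constants of the rate *)

Section Rate.
Context {R : realType}.

(** For small [y] the lower bound comes from [2 * m + 1 >= 3], for large [y] from
    [2 * m + 1 > y - 2]. *)
Lemma rate_dimension_bounds (y : R) (m : nat) : 1 <= y -> (1 <= m)%N ->
  `|(2 * m + 1)%:R - (Num.floor y)%:~R| <= 1 :> R ->
  y / 2 <= (2 * m + 1)%:R <= 2 * y.
Proof.
move=> y1 m1; have := floor_itv y; rewrite intrD.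
have D3 : 3 <= (2 * m + 1)%:R :> R by rewrite ler_nat; move: m1; lia.
move: ((2 * m + 1)%:R : R) ((Num.floor y)%:~R : R) D3 => D F D3 /andP[a b].
by rewrite ler_norml => /andP[c d]; apply/andP; split; lra.
Qed.

Lemma rate_powR (beta : R) n : 0 < beta -> (0 < n)%N ->
  n%:R `^ (1 / (2 * beta + 1)) / n%:R = n%:R `^ (- (2 * beta) / (2 * beta + 1)) :> R.
Proof.
move=> b0 n0; have nr : 0 < n%:R :> R by rewrite ltr0n.
rewrite -(powR_inv1 (ltW nr)) -powRD; last by rewrite (gt_eqF nr) implybT.
by congr powR; field; rewrite gt_eqF//; lra.
Qed.

Lemma rate_bias (beta y D : R) : 0 < beta -> 0 < y -> y / 2 <= D ->
  (D `^ beta) ^- 2 <= (2 `^ beta) ^+ 2 * y `^ (- (2 * beta)).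
Proof.
move=> b0 y0 yD; have y2 : 0 < y / 2 by rewrite divr_gt0.
have D0 : 0 < D by exact: lt_le_trans yD.
have P : 0 < (y / 2) `^ beta by rewrite powR_gt0.
apply: (@le_trans _ _ (((y / 2) `^ beta) ^- 2)).
  rewrite lef_pV2 ?posrE ?exprn_gt0 ?powR_gt0//.
  rewrite lerXn2r ?nnegrE ?powR_ge0// ge0_ler_powR ?nnegrE ?(ltW b0) ?(ltW y2)// ltW//.
have -> : (y / 2) `^ beta = y `^ beta / 2 `^ beta.
  by rewrite powRM ?invr_ge0 ?(ltW y0)// -[2^-1]powR_inv1// -powRrM mulN1r powRN.
rewrite exprMn exprVn invfM invrK mulrC.
by rewrite powRN (mulrC 2) powRrM powR_mulrn// powR_ge0.
Qed.

End Rate.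

Unset Implicit Arguments.

Theorem theorem2 (R : realType) :
  (* Part 1: non-asymptotic risk bound *)
  (forall sigma0 : R, 0 < sigma0 ->
   exists C1 C2 : R, forall M : R, 0 <= M -> exists C3 : R,
   forall (f : R -> R) (mu : {measure set (R * R)%type -> \bar R}),
     is_density f -> LU_law mu -> Linf_bound f M ->
     (forall x, circle x -> (sigma0%:E <= sigma mu x)%E) ->
     forall n m : nat, Mset n m ->
       (risk f mu n m <=
          C1%:E * l2sq (fun t => (fproj f m t - f t)%R)
          + (C2 * (2 * m + 1)%:R / n%:R + C3 / n%:R)%:E)%E)
  /\
  (* Part 2: rate of convergence over Sobolev ellipsoids *)
  (forall (f : R -> R) (mu : {measure set (R * R)%type -> \bar R})
          (sigma0 M beta Rad : R),
     is_density f -> LU_law mu -> 0 < sigma0 -> Linf_bound f M ->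
     (forall x, circle x -> (sigma0%:E <= sigma mu x)%E) ->
     0 < beta -> 0 < Rad -> sobolev beta Rad f ->
     forall mn : nat -> nat,
       (exists N0 : nat, forall n : nat, (N0 <= n)%N ->
          Mset n (mn n) /\
          `|(2 * mn n + 1)%:R
            - (Num.floor (n%:R `^ (1 / (2 * beta + 1))))%:~R| <= 1 :> R) ->
       exists (C : R) (N : nat), forall n : nat, (N <= n)%N ->
         (risk f mu n (mn n) <= (C * n%:R `^ (- (2 * beta) / (2 * beta + 1)))%:E)%E).
Proof.
split.
  move=> sigma0 /risk_oracle_inequality[C1 [C2 [_ [_ H]]]]; exists C1, C2 => M /H[C3 _ H3].
  by exists C3.
move=> f mu sigma0 M beta Rad df lu s00 fM hs b0 _ sob mn [N0 hN].
(* [M] comes without a sign here, while the oracle inequality asks for a nonnegative bound. *)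
have fM' : Linf_bound f `|M|.
  case: fM => A [mA A0 fA]; exists A; split=> //; apply: subset_trans fA.
  by apply: subsetC => t H ct; rewrite (le_trans (H ct))// ler_norm.
have [C1 [C2 [C10 [C20 H]]]] := risk_oracle_inequality s00.
have [C3 C30 {}H] := H `|M| (normr_ge0 M).
pose S := Rad ^+ 2 / pi `^ (2 * beta).
have S0 : 0 <= S by rewrite divr_ge0 ?sqr_ge0// powR_ge0.
(* Bias, variance and remainder in turn: the constants of [sobolev_fproj_dist] and [rate_bias], then
   the dimension at most [2 * y], then [1 <= y], where [y / n] is the rate. *)
exists (C1 * (S * (2 `^ beta) ^+ 2) + C2 * 2 + C3), N0 => n /hN[Mn hn].
apply: (le_trans (H f mu df lu fM' hs n (mn n) Mn)).
have [sf _] := density_sqint df (normr_ge0 M) fM'.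
rewrite l2sqE; last by apply: sqintB => //; exact: sqint_tpoly.
rewrite -EFinM -EFinD lee_fin.
have /andP[m1 mle] := Mn.
have n0 : (0 < n)%N by move: m1 mle; lia.
have n1 : 1 <= n%:R :> R by rewrite ler1n.
have nr : 0 < n%:R :> R by exact: lt_le_trans n1.
pose y : R := n%:R `^ (1 / (2 * beta + 1)).
have y1 : 1 <= y.
  have g0 : 0 <= 1 / (2 * beta + 1) by rewrite divr_ge0//; lra.
  have := @ge0_ler_powR R _ g0 1 n%:R; rewrite powR1; apply => //; first by rewrite nnegrE.
  by rewrite nnegrE.
have /andP[yD Dy] := rate_dimension_bounds y1 m1 hn.
have yn : y / n%:R = n%:R `^ (- (2 * beta) / (2 * beta + 1)) by exact: rate_powR.
have bias := sobolev_fproj_dist (mn n) df (normr_ge0 M) fM' b0 sob.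
have yb : y `^ (- (2 * beta)) = n%:R `^ (- (2 * beta) / (2 * beta + 1)).
  by rewrite /y -powRrM; congr powR; field; rewrite gt_eqF//; lra.
have bias' := rate_bias b0 (lt_le_trans ltr01 y1) yD; rewrite yb in bias'.
set r := n%:R `^ _ in yn bias' *; rewrite !mulrDl -addrA.
apply: lerD.
  rewrite -mulrA ler_wpM2l// (le_trans bias)// -/S -mulrA ler_wpM2l//.
apply: lerD.
  by rewrite -!mulrA ler_wpM2l// -yn mulrA ler_pM2r ?invr_gt0.
by rewrite ler_wpM2l// -yn -[leLHS]mul1r ler_pM2r ?invr_gt0.
Qed.
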